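(* If $(W,S)$ is a finite irreducible Coxeter system with Coxeter number $h$, then \[\operatorname{MC}(W)\,=\,\frac{h}{2}\,\sum_{s\in S}\operatorname{MC}(W_{\langle s\rangle}).\]
   Context: Let $(W,S)$ be a finite Coxeter system of rank $n=|S|$ and let $T$ be the set of reflections of $W$ (all conjugates of elements of $S$). The absolute length $\ell_T(w)$ of $w\in W$ is the minimal length of a word in the alphabet $T$ representing $w$; a word in $T$ for $w$ of this minimal length is a reduced $T$-word for $w$. The absolute order on $W$ sets $u\le v$ if and only if $u$ has a reduced $T$-word which is a prefix of some reduced $T$-word for $v$. A Coxeter element is $c=s_1s_2\cdots s_n$ with each element of $S$ occurring exactly once. The noncrossing partition lattice $L_W$ is the interval $[1,c]$ in the absolute order; its isomorphism type does not depend on the choice of $c$, and it is graded of rank $n$ with rank function $\ell_T$. The Coxeter number $h$ of an irreducible $W$ is the order of a Coxeter element. $\operatorname{MC}(W)$ denotes the number of maximal chains in $L_W$ (equal to $1$ when $W$ is trivial). For $s\in S$, $W_{\langle s\rangle}$ denotes the parabolic subgroup of $W$ generated by $S\setminus\{s\}$, regarded as a Coxeter system with simple reflections $S\setminus\{s\}$ (possibly reducible or trivial). *)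

(* Defs.v *)
From HB Require Import structures.
From mathcomp Require Import all_boot all_fingroup.
From mathcomp Require Import boolp.

Set Implicit Arguments.
Unset Strict Implicit.
Unset Printing Implicit Defensive.

Local Open Scope group_scope.

(* Bourbaki, Lie IV.1.3: W is generated by the set S of elements of order 2,
   and is presented by the relations (s * t) ^+ m(s, t) = 1, where m(s, t) is
   the order of s * t in W. The presentation is expressed by its universal
   property, over all groups H, finite or not; the case s = t, in which
   #[s * s] = 1, is the relation f s * f s = 1. *)
Definition coxeter_system (gT : finGroupType) (W : {group gT}) (S : {set gT}) :
    Prop :=
  [/\ <<S>> = W,
      forall s : gT, s \in S -> #[s] = 2
    & forall (H : groupType) (f : gT -> H),
        (forall s t : gT, s \in S -> t \in S -> (f s * f t) ^+ #[s * t] = 1) ->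
        exists phi : gT -> H,
          (forall x y : gT, x \in W -> y \in W -> phi (x * y) = phi x * phi y)
          /\ (forall s : gT, s \in S -> phi s = f s)].

Definition diagram_edge (gT : finGroupType) (S : {set gT}) : rel gT :=
  [rel s t | [&& s \in S, t \in S & 3 <= #[s * t]]].

(* The Coxeter diagram is connected; the empty diagram (trivial W) is not. *)
Definition coxeter_irreducible (gT : finGroupType) (S : {set gT}) : Prop :=
  S != set0 /\
  (forall s t : gT, s \in S -> t \in S -> connect (diagram_edge S) s t).

Definition reflections (gT : finGroupType) (W : {group gT}) (S : {set gT}) :
    {set gT} :=
  [set s ^ w | s in S, w in W].

Definition word_for (gT : finGroupType) (T : {set gT}) (w : gT) (r : seq gT) :
    Prop :=
  {subset r <= T} /\ \prod_(t <- r) t = w.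

Definition reduced_word (gT : finGroupType) (T : {set gT}) (w : gT)
    (r : seq gT) : Prop :=
  word_for T w r /\ (forall r' : seq gT, word_for T w r' -> size r <= size r').

Definition abs_le (gT : finGroupType) (T : {set gT}) : rel gT :=
  fun u v => `[< exists r1 r2 : seq gT,
    [/\ reduced_word T u r1, reduced_word T v r2 & prefix r1 r2] >].

Definition coxeter_element (gT : finGroupType) (S : {set gT}) (c : gT) : Prop :=
  exists r : seq gT, [/\ uniq r, r =i S & c = \prod_(s <- r) s].

Definition noncrossing_partitions (gT : finGroupType) (W : {group gT})
    (S : {set gT}) (c : gT) : {set gT} :=
  let T := reflections W S in
  [set w in W | abs_le T 1 w && abs_le T w c].

Definition is_chain (gT : finGroupType) (le : rel gT) (C : {set gT}) : bool :=
  [forall x in C, forall y in C, le x y || le y x].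

Definition maximal_chains (gT : finGroupType) (le : rel gT) (L : {set gT}) :
    {set {set gT}} :=
  [set C : {set gT} |
    maxset [pred D : {set gT} | (D \subset L) && is_chain le D] C].

(* The number of maximal chains of L_W, computed with the Coxeter element c. *)
Definition MC (gT : finGroupType) (W : {group gT}) (S : {set gT}) (c : gT) :
    nat :=
  #|maximal_chains (abs_le (reflections W S)) (noncrossing_partitions W S c)|.

Definition parabolic (gT : finGroupType) (S : {set gT}) (s : gT) :
    {group gT} :=
  <<S :\ s>>%G.

(* Main.v *)
Require Import Defs.
From HB Require Import structures.
From mathcomp Require Import all_boot all_order all_fingroup all_algebra.
From mathcomp Require Import boolp.
From mathcomp Require Import zify ring lra cyclic reals trigo.
From mathcomp Require classical_sets topology normedtype derive Rstruct.

(* A maximal chain of [1, c] is a factorization of c into n reflections. Writing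
   c = s_1 ... s_n, the factorizations that begin with
   t_i = (s_1 ... s_{i-1}) s_i (s_1 ... s_{i-1})^-1 are t_i followed by a factorization of
   the Coxeter element s_1 ... s_{i-1} s_{i+1} ... s_n of a maximal parabolic subgroup. The
   number of factorizations beginning with t is unchanged when t is conjugated by c, so it
   suffices that the conjugates of any reflection t by c^0, ..., c^(h-1) meet
   {t_1, ..., t_n} exactly twice. Now t_1, ..., t_n are the reflections whose positive root
   is made negative by c, so this says that the root of t changes sign twice in h steps. For
   a bipartite c it follows by projecting to the Coxeter plane: a positive eigenvector of
   the Gram matrix provides two coordinates that have the sign of the root and on which c
   acts through the Chebyshev recursion U_{k+1} = lam U_k - U_{k-1}; the first zero of U
   turns out to be h. Restricting to a bipartite c is harmless: the Gram matrix is positive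
   definite, so the diagram is a forest and all Coxeter elements are conjugate. *)

Set Implicit Arguments.
Unset Strict Implicit.
Unset Printing Implicit Defensive.

Import Order.TTheory GRing.Theory Num.Theory.

(** * Words and length *)

(** [coxeter_system] provides only a universal property, so parity of lengths, roots and parabolic
    subgroups all have to be extracted from representations. [W] acts on row vectors from the right,
    so that a word acts letter by letter in reading order. Maximal parabolic subgroups may be
    reducible and get no representation of their own: their reflections and factorizations are
    recognised inside that of [W], through the stabilizer of a fundamental weight. The orbit of a
    reflection under conjugation by c can be shorter than h; hits are therefore counted over the h
    powers of c. In the sum over all pairs of a reflection and a power, every factorization of c is
    counted twice and every one beginning with some t_i is counted h times, whence the factor h /
    2. *)

Section WordLength.
Local Open Scope group_scope.
Variables (gT : finGroupType) (A : {set gT}).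
Implicit Types (x y w : gT) (r : seq gT).

Lemma word_for_cat x y r1 r2 :
  word_for A x r1 -> word_for A y r2 -> word_for A (x * y) (r1 ++ r2).
Proof.
move=> [sub1 <-] [sub2 <-]; split; last by rewrite big_cat.
by move=> z; rewrite mem_cat => /orP[/sub1|/sub2].
Qed.

Lemma word_for1 : word_for A 1 [::].
Proof. by split=> //; rewrite big_nil. Qed.

Lemma word_for_letter x : x \in A -> word_for A x [:: x].
Proof. by move=> Ax; split; rewrite ?big_seq1 // => z /[!inE] /eqP->. Qed.

Lemma word_for_cons x w r : x \in A -> word_for A w r -> word_for A (x * w) (x :: r).
Proof. by move=> Ax; apply: (word_for_cat (word_for_letter Ax)). Qed.

Lemma word_for_uncons x w r :
  word_for A w (x :: r) -> x \in A /\ word_for A (x^-1 * w) r.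
Proof.
move=> [sub <-]; split; first by rewrite sub ?mem_head.
by split=> [z rz|]; [rewrite sub ?inE ?rz ?orbT | rewrite big_cons mulKg].
Qed.

Lemma word_for_gen w r : word_for A w r -> w \in <<A>>.
Proof.
by move=> [sub <-]; rewrite big_seq group_prod // => x /sub/mem_gen.
Qed.

Lemma gen_word_for w : w \in <<A>> -> exists r, word_for A w r.
Proof.
case/gen_prodgP => n [f fA ->]; exists [seq f i | i <- enum 'I_n]; split.
  by move=> _ /mapP[i _ ->].
by rewrite big_map enumT [index_enum _]unlock.
Qed.

(* 0 when w is not a product of elements of A. *)
Definition wlen w : nat :=
  if pselect (exists k, `[< exists r, word_for A w r /\ size r = k >])
  is left wordw then ex_minn wordw else 0.

Lemma wlen_le w r : word_for A w r -> wlen w <= size r.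
Proof.
move=> rw; rewrite /wlen; case: pselect => // p.
by case: ex_minnP => m _; apply; apply/asboolP; exists r.
Qed.

Lemma wlen_word w : w \in <<A>> -> exists2 r, word_for A w r & size r = wlen w.
Proof.
move=> /gen_word_for[r rw]; rewrite /wlen; case: pselect => [p|[]]; last first.
  by exists (size r); apply/asboolP; exists r.
by case: ex_minnP => m /asboolP[r' [? ?]] _; exists r'.
Qed.

Lemma wlen1 : wlen 1 = 0.
Proof. by apply/eqP; rewrite -leqn0 (wlen_le word_for1). Qed.

Lemma wlen_eq0 w : w \in <<A>> -> wlen w = 0 -> w = 1.
Proof.
move=> /wlen_word[r rw <-] /size0nil r0; move: rw; rewrite r0 => -[_ <-].
by rewrite big_nil.
Qed.

Lemma wlen_mul x y : x \in <<A>> -> y \in <<A>> -> wlen (x * y) <= wlen x + wlen y.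
Proof.
move=> /wlen_word[r1 w1 <-] /wlen_word[r2 w2 <-].
by rewrite -size_cat wlen_le //; apply: word_for_cat.
Qed.

Lemma wlen_letter x : x \in A -> wlen x <= 1.
Proof. by move=> /word_for_letter/wlen_le. Qed.

Lemma wlen_letter_mul x w : x \in A -> w \in <<A>> -> wlen (x * w) <= (wlen w).+1.
Proof.
move=> Ax Aw; apply: leq_trans (wlen_mul _ Aw) _; first exact: mem_gen.
by rewrite -add1n leq_add2r wlen_letter.
Qed.

Lemma wlen_peel w : w \in <<A>> -> w != 1 ->
  exists x w', [/\ x \in A, w' \in <<A>>, w = x * w' & wlen w = (wlen w').+1].
Proof.
move=> Aw w1; have [[|x r] rw szr] := wlen_word Aw.
  by move/esym/(wlen_eq0 Aw)/eqP: szr; rewrite (negPf w1).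
have [Ax rw'] := word_for_uncons rw; have Aw' := word_for_gen rw'.
exists x, (x^-1 * w); split; rewrite ?mulKVg //.
have := wlen_le rw'; have := wlen_letter_mul Ax Aw'; rewrite mulKVg.
by move: szr => /=; lia.
Qed.

End WordLength.

(** * Matrix representations from the presentation, and the parity of the length *)

Section Presentation.
Local Open Scope ring_scope.
Variables (F : comUnitRingType) (n : nat).

(** The universal property speaks of maps into groups, so the invertible matrices are packaged as a
    [groupType]; over the reals they do not in general form a [finGroupType]. *)
Definition gl := {M : 'M[F]_n | M \in unitmx}.
HB.instance Definition _ := Choice.on gl.

Definition gl_one : gl := exist _ 1%:M (unitmx1 F n).

Lemma gl_inv_subproof (M : gl) : invmx (val M) \in unitmx.
Proof. by rewrite unitmx_inv (valP M). Qed.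
Definition gl_inv (M : gl) : gl := exist _ (invmx (val M)) (gl_inv_subproof M).

Lemma gl_mul_subproof (M N : gl) : val M *m val N \in unitmx.
Proof. by rewrite unitmx_mul (valP M) (valP N). Qed.
Definition gl_mul (M N : gl) : gl := exist _ (val M *m val N) (gl_mul_subproof M N).

Lemma gl_mulA : associative gl_mul.
Proof. by move=> M N P; apply: val_inj; rewrite /= mulmxA. Qed.
Lemma gl_mul1g : left_id gl_one gl_mul.
Proof. by move=> M; apply: val_inj; rewrite /= mul1mx. Qed.
Lemma gl_mulg1 : right_id gl_one gl_mul.
Proof. by move=> M; apply: val_inj; rewrite /= mulmx1. Qed.
Lemma gl_mulVg : left_inverse gl_one gl_inv gl_mul.
Proof. by move=> M; apply: val_inj; rewrite /= mulVmx // (valP M). Qed.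
Lemma gl_mulgV : right_inverse gl_one gl_inv gl_mul.
Proof. by move=> M; apply: val_inj; rewrite /= mulmxV // (valP M). Qed.
HB.instance Definition _ :=
  isGroup.Build gl gl_mulA gl_mul1g gl_mulg1 gl_mulVg gl_mulgV.

Lemma val_glX (M : gl) k : val (M ^+ k)%g = val M ^+ k.
Proof. by elim: k => // k IH; rewrite expgS exprS -IH. Qed.

(** An involution is invertible, so the images of the letters lie in [gl]; outside [S], where [M]
    may be singular, [insubd] falls back on the identity. *)
Lemma coxeter_mxrep (gT : finGroupType) (W : {group gT}) (S : {set gT})
    (M : gT -> 'M[F]_n) :
    coxeter_system W S -> (forall s, s \in S -> M s *m M s = 1%:M) ->
    (forall s t, s \in S -> t \in S -> (M s *m M t) ^+ #[s * t]%g = 1%:M) ->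
  exists rho : gT -> 'M[F]_n,
    [/\ {in W &, forall x y, rho (x * y)%g = rho x *m rho y},
        rho 1%g = 1%:M & {in S, rho =1 M}].
Proof.
move=> [genS ordS univ] MM relM.
have unitM s : s \in S -> M s \in unitmx by move=> /MM/mulmx1_unit[].
pose f s : gl := insubd gl_one (M s).
have fE s : s \in S -> val (f s) = M s by move=> Ss; rewrite val_insubd unitM.
have [|phi [phiM phiS]] := univ gl f.
  by move=> s t Ss St; apply: val_inj; rewrite val_glX /= !fE // relM.
exists (fun x => val (phi x)); split=> [x y Wx Wy||s Ss].
- by rewrite phiM.
- suff -> : phi 1%g = 1%g by [].
  by apply: (mulgI (phi 1%g)); rewrite -phiM ?group1 // !mulg1.
- by rewrite phiS // fE.
Qed.

End Presentation.

Section CoxeterGroup.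
Local Open Scope group_scope.
Variables (gT : finGroupType) (W : {group gT}) (S : {set gT}).
Hypothesis hWS : coxeter_system W S.

Lemma cox_gen : <<S>> = W. Proof. by case: hWS. Qed.
Lemma cox_sub : {subset S <= W}.
Proof. by move=> s Ss; rewrite -cox_gen mem_gen. Qed.
Lemma cox_invol s : s \in S -> s * s = 1.
Proof. by case: hWS => _ ord2 _ Ss; rewrite -[s * s]/(s ^+ 2) -(ord2 s Ss) expg_order. Qed.

Lemma cox_peel w : w \in W -> w != 1 ->
  exists s w', [/\ s \in S, w' \in W, w = s * w' & wlen S w = (wlen S w').+1].
Proof. by rewrite -cox_gen; apply: wlen_peel. Qed.

(** The parity of the length is the sign character: sending every letter to the 1 by 1 integer
    matrix -1 respects the relations, because each of them has an even number of letters. *)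
Lemma cox_wlen_neq s w : s \in S -> w \in W -> wlen S (s * w) <> wlen S w.
Proof.
move=> Ss Ww.
have [|s' t' Ss' St'|rho [rhoM rho1 rhoS]] :=
    coxeter_mxrep (M := fun=> (- (1%:M) : 'M[int]_1)%R) hWS.
- by move=> s' _; rewrite mulNmx mulmxN opprK mulmx1.
- by rewrite mulNmx mulmxN opprK mulmx1 expr1n.
have rho_len x : x \in W -> rho x = (((-1) ^+ wlen S x)%:M)%R.
  have [k] := ubnP (wlen S x); elim: k x => // k IH x lt_k Wx.
  have [->|/(cox_peel Wx)[t [y [St Wy xE lenE]]]] := eqVneq x 1.
    by rewrite wlen1 rho1.
  rewrite lenE xE rhoM ?(cox_sub St) // rhoS // IH //; last by rewrite -ltnS -lenE.
  by rewrite exprS mulN1r mulNmx mul1mx raddfN.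
move=> eq_len; have := rhoM _ _ (cox_sub Ss) Ww.
rewrite (rho_len _ Ww) (rho_len _ (groupM (cox_sub Ss) Ww)) eq_len rhoS // mulNmx mul1mx.
move=> /(congr1 (fun M : 'M_1 => M 0 0)%R); rewrite !mxE /= mulr1n => /eqP.
by rewrite -addr_eq0 -mulr2n mulrn_eq0 /= signr_eq0.
Qed.

Lemma cox_wlen_cases s w : s \in S -> w \in W ->
  wlen S (s * w) = (wlen S w).+1 \/ wlen S w = (wlen S (s * w)).+1.
Proof.
move=> Ss Ww; have := cox_wlen_neq Ss Ww.
have Sw : w \in <<S>> by rewrite cox_gen.
have Ssw : s * w \in <<S>> by rewrite cox_gen groupM // cox_sub.
have := wlen_letter_mul Ss Sw; have := wlen_letter_mul Ss Ssw.
rewrite mulgA cox_invol // mul1g; move: (wlen S (s * w)) (wlen S w) => a b; lia.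
Qed.

End CoxeterGroup.

Section AlternatingWords.
Local Open Scope group_scope.
Variable gT : finGroupType.
Implicit Types s t : gT.

Fixpoint altg s t k : gT := if k is k'.+1 then s * altg t s k' else 1.

Lemma altg_divV s t k : s * s = 1 -> t * t = 1 ->
  altg s t k * (altg t s k)^-1 = (s * t) ^+ k.
Proof.
move=> s2 t2; have tV : t^-1 = t by apply/eqP; rewrite eq_invg_mul t2.
have sV : s^-1 = s by apply/eqP; rewrite eq_invg_mul s2.
elim: k s t s2 t2 sV tV => [|k IH] s t s2 t2 sV tV; first by rewrite mul1g invg1.
rewrite /= invMg mulgA -(mulgA s) IH // tV expgSr.
elim: k {IH} => [|k IH]; first by rewrite !expg0 mulg1 mul1g.
by rewrite !expgSr !mulgA in IH *; rewrite IH.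
Qed.

(** The braid relation: the two alternating products of length k differ by the k-th power of
    [s * t], which is 1 when k is its order. *)
Lemma altg_swap s t : s * s = 1 -> t * t = 1 ->
  altg s t #[s * t] = altg t s #[s * t].
Proof.
by move=> s2 t2; apply/eqP; rewrite eq_mulgV1 altg_divV // expg_order.
Qed.

Lemma altg_add s t j k :
  altg s t (j + k) = altg s t j * (if odd j then altg t s k else altg s t k).
Proof.
elim: j s t => [|j IH] s t /=; first by rewrite mul1g.
by rewrite IH mulgA; case: (odd j).
Qed.

Lemma word_for_altg (A : {set gT}) s t k : s \in A -> t \in A ->
  exists2 r, word_for A (altg s t k) r & size r = k.
Proof.
elim: k s t => [|k IH] s t As At /=; first by exists [::] => //; apply: word_for1.
by have [r rk szr] := IH t s At As; exists (s :: r); [apply: word_for_cons|rewrite /= szr].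
Qed.

End AlternatingWords.

(** * Maximal chains as factorizations *)

Section AbsoluteOrder.
Local Open Scope group_scope.
Variables (gT : finGroupType) (T : {set gT}).
Implicit Types (u v w c : gT) (r : seq gT).

Lemma reduced_wordP w r : reduced_word T w r <-> word_for T w r /\ size r = wlen T w.
Proof.
split=> [[rw min]|[rw szr]]; split=> //; last by move=> r' /wlen_le; rewrite szr.
have [r' rw' szr'] := wlen_word (word_for_gen rw).
by apply/eqP; rewrite eqn_leq (wlen_le rw) andbT -szr' min.
Qed.

Lemma abs_leP u v : u \in <<T>> -> v \in <<T>> ->
  abs_le T u v <-> wlen T v = wlen T u + wlen T (u^-1 * v).
Proof.
move=> Tu Tv; have Tuv : u^-1 * v \in <<T>> by rewrite groupM ?groupV.
split=> [/asboolP[r1 [r2 [/reduced_wordP[w1 sz1] /reduced_wordP[w2 sz2] /prefixP[q r2E]]]]|lenE].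
  apply/eqP; rewrite eqn_leq -{1}[v](mulKVg u) wlen_mul //= -sz2 r2E size_cat sz1.
  rewrite leq_add2l wlen_le //; move: w1 w2 => [_ <-] [sub <-]; split=> [z qz|].
    by rewrite sub // r2E mem_cat qz orbT.
  by rewrite r2E big_cat mulKg.
have [r1 w1 sz1] := wlen_word Tu; have [q wq szq] := wlen_word Tuv.
apply/asboolP; exists r1, (r1 ++ q); split; [exact/reduced_wordP| |exact: prefix_prefix].
apply/reduced_wordP; split; last by rewrite size_cat sz1 szq lenE.
by have := word_for_cat w1 wq; rewrite mulKVg.
Qed.

Lemma abs_le_gen u v : abs_le T u v -> u \in <<T>> /\ v \in <<T>>.
Proof.
move=> /asboolP[r1 [r2 [[w1 _] [w2 _] _]]].
by split; [apply: word_for_gen w1|apply: word_for_gen w2].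
Qed.

Lemma abs_le_wlen u v : abs_le T u v -> wlen T u <= wlen T v.
Proof.
by move=> uv; have [Tu Tv] := abs_le_gen uv; have /(abs_leP Tu Tv)-> := uv; apply: leq_addr.
Qed.

Lemma abs_le_eq u v : abs_le T u v -> wlen T u = wlen T v -> u = v.
Proof.
move=> uv; have [Tu Tv] := abs_le_gen uv; have /(abs_leP Tu Tv)-> := uv => e.
have e0 : wlen T (u^-1 * v) = 0 by lia.
by apply/eqP; rewrite eq_mulVg1; apply/eqP; apply: wlen_eq0 e0; rewrite groupM ?groupV.
Qed.

Lemma abs_le1 w : w \in <<T>> -> abs_le T 1 w.
Proof. by move=> Tw; apply/abs_leP; rewrite ?group1 // invg1 mul1g wlen1. Qed.

Lemma abs_le_refl w : w \in <<T>> -> abs_le T w w.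
Proof. by move=> Tw; apply/abs_leP => //; rewrite mulVg wlen1 addn0. Qed.

Definition facts k w : {set k.-tuple gT} :=
  [set r : k.-tuple gT | all (mem T) r && (\prod_(t <- r) t == w)].

Lemma factsP k w (r : k.-tuple gT) : reflect (word_for T w r) (r \in facts k w).
Proof.
rewrite inE; apply: (iffP andP) => [[/allP sub /eqP pr]|[sub pr]]; split=> //.
- by apply/allP.
- by apply/eqP.
Qed.

Arguments factsP {k w r}.

(** For a shortest factorization of c these products form a saturated chain from 1 to c, with one
    element in each rank. *)
Definition prefix_prods k (r : k.-tuple gT) : {set gT} :=
  [set \prod_(t <- take i r) t | i : 'I_k.+1].

Section Interval.
Variable c : gT.
Hypothesis Tc : c \in <<T>>.
Local Notation k := (wlen T c).

Lemma wlen_take (r : k.-tuple gT) i : r \in facts k c -> i <= k ->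
  wlen T (\prod_(t <- take i r) t) = i.
Proof.
move=> /factsP[sub pr] ik.
have w1 : word_for T (\prod_(t <- take i r) t) (take i r).
  by split=> // z /mem_take/sub.
have w2 : word_for T (\prod_(t <- drop i r) t) (drop i r).
  by split=> // z /mem_drop/sub.
have := wlen_le w1; have := wlen_le w2.
have := wlen_mul (word_for_gen w1) (word_for_gen w2).
rewrite -big_cat cat_take_drop pr size_take size_drop size_tuple.
by move: ik; case: (ltngtP i k); lia.
Qed.

Lemma take_gen (r : k.-tuple gT) i : r \in facts k c -> \prod_(t <- take i r) t \in <<T>>.
Proof.
move=> /factsP[sub pr]; rewrite big_seq group_prod // => z /mem_take/sub.
exact: mem_gen.
Qed.

Lemma take_abs_le (r : k.-tuple gT) i j : r \in facts k c -> i <= j -> j <= k ->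
  abs_le T (\prod_(t <- take i r) t) (\prod_(t <- take j r) t).
Proof.
move=> rc ij jk; apply/abs_leP; rewrite ?take_gen // !wlen_take ?(leq_trans ij) //.
have e : \prod_(t <- take j r) t =
    \prod_(t <- take i r) t * \prod_(t <- drop i (take j r)) t.
  rewrite -big_cat; congr bigop; rewrite -[LHS](cat_take_drop i); congr cat.
  by rewrite take_takel.
rewrite e mulKg; have [sub _] := factsP rc.
have w2 : word_for T (\prod_(t <- drop i (take j r)) t) (drop i (take j r)).
  by split=> // z /mem_drop/mem_take/sub.
have := wlen_mul (take_gen i rc) (word_for_gen w2); rewrite -e !wlen_take ?(leq_trans ij) //.
have := wlen_le w2; rewrite size_drop size_take size_tuple.
by move: jk; case: (ltngtP j k); lia.
Qed.

Lemma take_full (r : k.-tuple gT) : r \in facts k c -> \prod_(t <- take k r) t = c.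
Proof. by move=> /factsP[_ pr]; rewrite take_oversize ?size_tuple. Qed.

(** The length of a partial product tells its position in the chain, and the letters are the
    quotients of consecutive elements. *)
Lemma prefix_prods_inj : {in facts k c &, injective (@prefix_prods k)}.
Proof.
move=> r r' rc r'c e.
have take_eq i : i <= k -> \prod_(t <- take i r) t = \prod_(t <- take i r') t.
  move=> ik; have : \prod_(t <- take i r) t \in prefix_prods r.
    by apply/imsetP; exists (inord i); rewrite ?inordK.
  rewrite e => /imsetP[j _ ej]; have := congr1 (wlen T) ej.
  have jk : j <= k by rewrite -ltnS.
  by rewrite (wlen_take rc ik) (wlen_take r'c jk) => ij; rewrite ej ij.
apply/val_inj/(@eq_from_nth _ 1); rewrite !size_tuple // => i ik.
have := take_eq i.+1 ik; rewrite !(take_nth 1) ?size_tuple // -!cats1 !big_cat !big_seq1.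
by rewrite (take_eq i (ltnW ik)) => /mulgI.
Qed.

End Interval.

(** Induction on the length of c: if m is the top of the chain below c, refine the chain up to m,
    then continue with a shortest word for [m^-1 * c]; lengths add because m lies below c. *)
Lemma chain_sub_prefix_prods c (C : {set gT}) : c \in <<T>> -> is_chain (abs_le T) C ->
  {in C, forall w, abs_le T w c} ->
  exists2 r : (wlen T c).-tuple gT, r \in facts (wlen T c) c & C \subset prefix_prods r.
Proof.
have [l] := ubnP (wlen T c); elim: l c C => // l IH c C lt_l Tc chC leC.
have [c1|c1] := eqVneq c 1.
  have [r0 r0c szr0] := wlen_word Tc.
  exists (Tuple (introT eqP szr0)); first by apply/factsP.
  apply/fintype.subsetP => w Cw; apply/imsetP; exists ord0 => //=; rewrite take0 big_nil.
  have [Tw _] := abs_le_gen (leC w Cw).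
  apply: wlen_eq0 Tw _; have := abs_le_wlen (leC w Cw); rewrite c1 wlen1; lia.
pose D := C :\ c.
(* A longest element of [C] other than c dominates the rest of the chain; 1 stands in when nothing
   is left. *)
have [m [mc mD]] : exists m, [/\ abs_le T m c, m != c & {in D, forall w, abs_le T w m}].
  have [D0|[w0 Dw0]] := set_0Vmem D.
    exists 1; split; rewrite 1?eq_sym ?abs_le1 // => w; by rewrite D0 inE.
  case: (arg_maxnP (wlen T) Dw0) => m Dm max_m; have /setD1P[mc Cm] := Dm.
  exists m; split=> // [|w Dw]; first exact: leC.
  have /setD1P[wc Cw] := Dw.
  have /orP[//|mw] := forall_inP (forall_inP chC w Cw) m Cm.
  have := max_m w Dw; have := abs_le_wlen mw => l1 l2.
  have e : wlen T m = wlen T w by apply/eqP; rewrite eqn_leq l1.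
  by rewrite (abs_le_eq mw e); apply: abs_le_refl; have [] := abs_le_gen mw.
move=> leD; have [Tm _] := abs_le_gen mc.
have lt_m : wlen T m < wlen T c.
  by rewrite ltn_neqAle abs_le_wlen // andbT; apply/eqP => /(abs_le_eq mc)/eqP; apply/negP.
have [|r1 r1m Dr1] := IH m D (leq_trans lt_m lt_l) Tm _ leD.
  apply/forall_inP => x /setD1P[_ Cx]; apply/forall_inP => y /setD1P[_ Cy].
  exact: (forall_inP (forall_inP chC x Cx)).
have lenc := (abs_leP Tm Tc).1 mc.
have [q wq szq] := wlen_word (groupM (groupVr Tm) Tc).
have szr : size (r1 ++ q) == wlen T c by rewrite size_cat size_tuple szq lenc.
exists (Tuple szr).
  by apply/factsP => /=; have := word_for_cat (factsP r1m) wq; rewrite mulKVg.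
apply/fintype.subsetP => w Cw; have [->|wc] := eqVneq w c.
  apply/imsetP; exists ord_max => //=; rewrite take_oversize -?(eqP szr) //.
  by have [_] := word_for_cat (factsP r1m) wq; rewrite mulKVg => ->.
have /(fintype.subsetP Dr1)/imsetP[i _ ->] : w \in D by rewrite !inE wc.
have im : i <= wlen T m by rewrite -ltnS.
apply/imsetP; exists (inord i) => //=; rewrite inordK; last by lia.
by rewrite takel_cat // size_tuple.
Qed.

End AbsoluteOrder.

Section MaximalChains.
Local Open Scope group_scope.
Variables (gT : finGroupType) (W : {group gT}) (S : {set gT}).
Local Notation T := (reflections W S).

(** Partial products put factorizations in bijection with maximal chains: such a chain meets every
    rank, so it cannot be enlarged, and every chain is contained in one of these. *)
Lemma MC_facts c : T \subset W -> c \in <<T>> -> MC W S c = #|facts T (wlen T c) c|.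
Proof.
move=> TW Tc; set k := wlen T c.
have genW w : w \in <<T>> -> w \in W by apply/fintype.subsetP; rewrite gen_subG.
have inL w : (w \in noncrossing_partitions W S c) = abs_le T w c.
  rewrite !inE; apply/idP/idP => [/and3P[]//|wc]; have [Tw _] := abs_le_gen wc.
  by rewrite genW // abs_le1 // wc.
have chain_prefix r : r \in facts T k c ->
    (prefix_prods r \subset noncrossing_partitions W S c) &&
    is_chain (abs_le T) (prefix_prods r).
  move=> rc; apply/andP; split.
    apply/fintype.subsetP => _ /imsetP[i _ ->]; rewrite inL -[in X in abs_le _ _ X](take_full rc).
    by apply: take_abs_le => //; rewrite -ltnS.
  apply/forall_inP => _ /imsetP[i _ ->]; apply/forall_inP => _ /imsetP[j _ ->].
  have [ik jk] : i <= k /\ j <= k by split; rewrite -ltnS ltn_ord.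
  have [ij|/ltnW ji] := leqP i j; first by rewrite take_abs_le.
  by rewrite [X in _ || X]take_abs_le ?orbT.
have max_prefix r (D : {set gT}) : r \in facts T k c -> D \subset noncrossing_partitions W S c ->
    is_chain (abs_le T) D -> prefix_prods r \subset D -> D = prefix_prods r.
  move=> rc DL chD rD; apply/eqP; rewrite eqEsubset rD andbT.
  apply/fintype.subsetP => x Dx.
  have : x \in noncrossing_partitions W S c by apply: (fintype.subsetP DL).
  rewrite inL => xc; have xk : wlen T x <= k by apply: abs_le_wlen.
  set y := \prod_(t <- take (wlen T x) r) t.
  have ry : y \in prefix_prods r by apply/imsetP; exists (inord (wlen T x)); rewrite ?inordK.
  have Dy := fintype.subsetP rD _ ry.
  have leny : wlen T y = wlen T x by apply: wlen_take.
  suff -> : x = y by [].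
  have /orP[le|le] := forall_inP (forall_inP chD x Dx) y Dy.
    by apply: (abs_le_eq le).
  by apply/esym; apply: (abs_le_eq le).
rewrite /MC -(card_in_imset (prefix_prods_inj Tc)); congr #|pred_of_set _|.
apply/setP => C; rewrite inE; apply/maxsetP/imsetP => /= [[/andP[CL chC] maxC]|[r rc ->]].
  have [w Cw|r rc Cr] := chain_sub_prefix_prods Tc chC.
    by rewrite -inL (fintype.subsetP CL).
  by exists r => //; rewrite (maxC _ (chain_prefix _ rc) Cr).
split; first exact: chain_prefix.
by move=> D /andP[DL chD] rD; apply: max_prefix.
Qed.

End MaximalChains.

Section Factorizations.
Local Open Scope group_scope.
Variables (gT : finGroupType) (T : {set gT}).

Lemma card_facts_recl k c :
  #|facts T k.+1 c| = (\sum_(t in T) #|facts T k (t^-1 * c)|)%N.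
Proof.
rewrite -sum1_card (partition_big (@thead _ _) (mem T)) /=; last first.
  by move=> r; case/tupleP: r => t r /factsP[sub _]; rewrite theadE sub ?mem_head.
apply: eq_bigr => t Tt; rewrite sum1_card.
rewrite -(card_imset _ (f := fun r : k.-tuple gT => [tuple of t :: r])); last first.
  by move=> r1 r2 /(congr1 val)[] /val_inj.
apply: eq_card => r; apply/andP/imsetP => [[rc /eqP tr]|[r' /factsP r'c ->]].
  case/tupleP: r rc tr => t' r rc; rewrite theadE => <-; exists r => //.
  by apply/factsP; have /factsP/word_for_uncons[_] := rc.
by rewrite theadE eqxx; split=> //; apply/factsP; have := word_for_cons Tt r'c; rewrite mulKVg.
Qed.

Lemma card_factsJ k c w : {in T, forall t, t ^ w \in T} -> {in T, forall t, t ^ w^-1 \in T} ->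
  #|facts T k (c ^ w)| = #|facts T k c|.
Proof.
move=> Tw TwV; pose f (r : k.-tuple gT) := [tuple of map (conjg^~ w) r].
have f_inj : injective f.
  by move=> r1 r2 /(congr1 val) /= /(inj_map (conjg_inj w))/val_inj.
have prodJ (r : seq gT) v : \prod_(t <- [seq x ^ v | x <- r]) t = (\prod_(t <- r) t) ^ v.
  by rewrite big_map; elim/big_rec2: _ => [|t x y _ ->]; rewrite ?conj1g ?conjMg.
rewrite -[RHS](card_imset _ f_inj); apply: eq_card => r; apply/factsP/imsetP.
  move=> [sub pr]; exists [tuple of map (conjg^~ w^-1) r].
    apply/factsP; split=> [_ /mapP[t /sub Tt ->]|]; first exact: TwV.
    by rewrite prodJ pr conjgK.
  apply: val_inj => /=; rewrite -map_comp map_id_in // => t _ /=; by rewrite conjgKV.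
move=> [r' /factsP[sub pr] ->]; split=> [_ /mapP[t /sub Tt ->]|]; first exact: Tw.
by rewrite prodJ pr.
Qed.

End Factorizations.

(** * Rearrangements of a Coxeter word *)

Section CyclicEquivalence.
Variables (n : nat) (adj : rel 'I_n).
Hypothesis adjC : symmetric adj.
Implicit Types (r : seq 'I_n) (i j : 'I_n).

(** The moves are chosen to keep the product of a word in its conjugacy class: a rotation conjugates
    by the first letter, and a swap changes nothing once non-adjacent letters commute. *)
Inductive cyc_eq : seq 'I_n -> seq 'I_n -> Prop :=
| CycRefl r : cyc_eq r r
| CycSym r1 r2 : cyc_eq r1 r2 -> cyc_eq r2 r1
| CycTrans r1 r2 r3 : cyc_eq r1 r2 -> cyc_eq r2 r3 -> cyc_eq r1 r3
| CycRot i r : cyc_eq (i :: r) (rcons r i)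
| CycSwap a i j b : ~~ adj i j -> cyc_eq (a ++ i :: j :: b) (a ++ j :: i :: b).

Lemma cyc_eq_perm r1 r2 : cyc_eq r1 r2 -> perm_eq r1 r2.
Proof.
elim=> {r1 r2} [r|r1 r2 _|r1 r2 r3 _ + _|i r|a i j b _] //.
- by rewrite perm_sym.
- exact: perm_trans.
- by rewrite perm_sym perm_rcons.
- by rewrite perm_cat2l (perm_catCA [:: i] [:: j] b).
Qed.

Lemma cyc_eq_rot a b : cyc_eq (a ++ b) (b ++ a).
Proof.
elim: a b => [|i a IH] b /=; first by rewrite cats0; apply: CycRefl.
apply: CycTrans (CycRot _ _) _; rewrite rcons_cat.
by apply: CycTrans (IH _) _; rewrite cat_rcons; apply: CycRefl.
Qed.

Lemma cyc_eq_slide a i r : all (fun j => ~~ adj i j) r ->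
  cyc_eq (a ++ rcons r i) (a ++ i :: r).
Proof.
elim: r a => [|j r IH] a /=; first by move=> _; apply: CycRefl.
move=> /andP[ij /IH{}IH]; have := IH (rcons a j); rewrite !cat_rcons => e.
by apply: CycTrans e _; apply: CycSwap; rewrite adjC.
Qed.

(* In a rotation of r1, the letter i commutes either with the letter that is moved or with
   all the others. *)
Lemma cyc_eq_cons i r1 r2 : cyc_eq r1 r2 -> count (adj i) r1 <= 1 ->
  cyc_eq (i :: r1) (i :: r2).
Proof.
elim=> {r1 r2} [r|r1 r2 e12 IH|r1 r2 r3 e12 IH1 _ IH2|k r|a k j b kj] cnt.
- exact: CycRefl.
- by apply/CycSym/IH; have /seq.permP-> := cyc_eq_perm e12.
- by apply: CycTrans (IH1 cnt) (IH2 _); have /seq.permP<- := cyc_eq_perm e12.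
- have [ik|ik] := boolP (adj i k).
    have free : all (fun j => ~~ adj i j) r.
      rewrite all_predC has_count -leqNgt; move: cnt; rewrite /= ik add1n ltnS //.
    apply: CycTrans (CycRot _ _) _; apply: CycTrans (cyc_eq_slide [:: k] free) _.
    exact: CycRot.
  apply: CycTrans (CycSwap [::] r ik) _; exact: CycRot.
- exact: (CycSwap (i :: a)).
Qed.

(** Acyclicity, in the form consumed by inductions that delete a leaf. *)
Hypothesis forest : forall J : {set 'I_n}, J != set0 ->
  exists2 i, i \in J & #|[set j in J | (j != i) && adj i j]| <= 1.

(** Rotate a leaf to the front of both words; the remainders are equivalent by induction, and
    [cyc_eq_cons] restores the leaf because it has at most one neighbour. *)
Lemma cyc_eq_arrangements r1 r2 : uniq r1 -> uniq r2 -> r1 =i r2 -> cyc_eq r1 r2.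
Proof.
have [k] := ubnP (size r1); elim: k r1 r2 => // k IH r1 r2 lt_k u1 u2 e12.
case r1E : r1 => [|i0 r1'].
  suff -> : r2 = [::] by apply: CycRefl.
  by case: r2 {u2} e12 => // j r2 /(_ j); rewrite r1E mem_head.
have J0 : [set j in r1] != set0 by apply/set0Pn; exists i0; rewrite inE r1E mem_head.
have [i] := forest J0; rewrite inE => ri leaf; rewrite -r1E.
have rot_to r : i \in r -> uniq r -> exists2 x, cyc_eq r (i :: x) & perm_eq r (i :: x).
  move=> /splitPr[a b] _; exists (b ++ a); first exact: cyc_eq_rot (i :: b).
  by rewrite perm_catC.
have [x1 c1 p1] := rot_to _ ri u1.
have [x2 c2 p2] := rot_to r2 (etrans (esym (e12 i)) ri) u2.
apply: CycTrans c1 _; apply: CycTrans _ (CycSym c2).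
move: u1 u2; rewrite (perm_uniq p1) (perm_uniq p2) => /= /andP[ix1 u1] /andP[ix2 u2].
apply: cyc_eq_cons.
  apply: IH => //; first by move: lt_k; rewrite (perm_size p1).
  move=> j; have := e12 j; rewrite (perm_mem p1) (perm_mem p2) !inE.
  have [->|//] := eqVneq j i; by rewrite (negPf ix1) (negPf ix2).
apply: leq_trans leaf; rewrite -size_filter -(card_uniqP (filter_uniq _ u1)).
apply/subset_leq_card/fintype.subsetP => j.
rewrite !inE mem_filter (perm_mem p1) inE => /andP[-> jx].
by rewrite jx orbT andbT; apply: contraNneq ix1 => <-.
Qed.

(** Delete a leaf, colour the rest, then give the leaf the colour opposite to that of its only
    neighbour. *)
Lemma forest_coloring : exists col : 'I_n -> bool, forall i j,
  i != j -> adj i j -> col i != col j.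
Proof.
suff : forall J : {set 'I_n}, exists col : 'I_n -> bool,
    {in J &, forall i j, i != j -> adj i j -> col i != col j}.
  by move=> /(_ [set: 'I_n])[col colP]; exists col => i j; apply: colP; rewrite inE.
move=> J; have [k] := ubnP #|J|; elim: k J => // k IH J lt_k.
have [J0|/forest[i Ji leaf]] := eqVneq J set0.
  by exists xpredT => i j; rewrite J0 inE.
have [|col colP] := IH (J :\ i); first by move: lt_k; rewrite (cardsD1 i) Ji.
pose c := if [pick j in J | (j != i) && adj i j] is Some j then ~~ col j else true.
have cP j : j \in J -> j != i -> adj i j -> c != col j.
  move=> Jj ji ij; rewrite /c; case: pickP => [l /and3P[Jl li il]|/(_ j)]; last first.
    by rewrite /= Jj ji ij.
  suff -> : l = j by case: (col j).
  by apply: (card_le1_eqP leaf); rewrite inE ?Jl ?li ?il ?Jj ?ji ?ij.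
exists (fun j => if j == i then c else col j) => j l Jj Jl jl ajl.
have [ji|ji] := eqVneq j i; have [li|li] := eqVneq l i.
- by move: jl; rewrite ji li eqxx.
- by apply: cP; rewrite // -ji.
- by rewrite eq_sym; apply: cP; rewrite // -li adjC.
- by apply: colP; rewrite // !inE ?ji ?li.
Qed.

End CyclicEquivalence.

(** * Sign changes in periodic sequences *)

Section Periodic.

Lemma sum_shift_periodic (f : nat -> nat) m k0 : (forall k, f (k + m)%N = f k) ->
  (\sum_(k < m) f (k + k0) = \sum_(k < m) f k)%N.
Proof.
move=> per; elim: k0 => [|k0 <-]; first by apply: eq_bigr => k _; rewrite addn0.
case: m per => [|m] per; first by rewrite !big_ord0.
rewrite big_ord_recr [RHS]big_ord_recl /= addnC.
congr (_ + _)%N; first by rewrite -[RHS]per; congr f; lia.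
by apply: eq_bigr => k _; congr f; rewrite /= /bump; lia.
Qed.

Lemma periodic_descent (s : nat -> bool) m k1 k2 : (0 < m)%N ->
  (forall k, s (k + m)%N = s k) -> s k1 -> ~~ s k2 -> exists2 k, s k & ~~ s k.+1.
Proof.
move=> m0 per s1 s2; have perj j k : s (k + j * m)%N = s k.
  by elim: j => [|j IH]; rewrite ?addn0 // mulSn addnCA addnC per IH.
apply: contrapT => no.
have up j : s (k1 + j)%N.
  elim: j => [|j IH]; first by rewrite addn0.
  by rewrite addnS; apply: contrapT => /negP sj; apply: no; exists (k1 + j)%N.
(* The offset leads from [k1] to [k2 + k1 * m], which is congruent to [k2] and not smaller than
   [k1]. *)
have := up (k2 + k1 * m - k1)%N; rewrite subnKC; last by nia.
by rewrite perj; apply/negP.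
Qed.

(** The sequence is true at 0, false from 1 to p and true from p + 1 to m, so it changes only at the
    steps 0 and p. *)
Lemma sum_two_changes (s : nat -> bool) m p : (0 < p < m)%N ->
  s 0%N -> (forall k, (k < m)%N -> s k.+1 = (p <= k)%N) ->
  (\sum_(k < m) (s k != s k.+1) = 2)%N.
Proof.
move=> /andP[p0 pm] s0 sS; have m0 : (0 < m)%N by lia.
rewrite (bigD1 (Ordinal m0)) //= s0 sS // leqNgt p0 /=.
rewrite (bigD1 (Ordinal pm)) /=; last by rewrite -val_eqE /=; lia.
rewrite big1 => [|[k km] /andP[]]; last first.
  rewrite -!val_eqE /=; case: k km => // k km _ kp.
  by rewrite !sS //; [lia|lia].
case: p p0 pm {sS} (sS p.-1) (sS p) => // p _ pm s1 s2.
by rewrite s1 ?s2 //=; lia.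
Qed.

End Periodic.

(** * Quadratic forms and rotations *)

Section Form.
Local Open Scope ring_scope.
Variables (R : realFieldType) (n : nat) (B : 'M[R]_n).
Hypothesis symB : B^T = B.
Implicit Types x y z a b : 'rV[R]_n.

Definition bf x y : R := (x *m B *m y^T) 0 0.

Lemma bfDl x y z : bf (x + y) z = bf x z + bf y z.
Proof. by rewrite /bf !mulmxDl mxE. Qed.
Lemma bfZl k x y : bf (k *: x) y = k * bf x y.
Proof. by rewrite /bf -!scalemxAl mxE. Qed.
Lemma bfC x y : bf x y = bf y x.
Proof. by rewrite /bf -[x *m B *m y^T]trmxK mxE !trmx_mul trmxK symB mulmxA. Qed.
Lemma bfDr x y z : bf x (y + z) = bf x y + bf x z.
Proof. by rewrite !(bfC x) bfDl. Qed.
Lemma bfZr k x y : bf x (k *: y) = k * bf x y.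
Proof. by rewrite !(bfC x) bfZl. Qed.
Lemma bfNl x y : bf (- x) y = - bf x y.
Proof. by rewrite -scaleN1r bfZl mulN1r. Qed.
Lemma bfNr x y : bf x (- y) = - bf x y.
Proof. by rewrite -scaleN1r bfZr mulN1r. Qed.
Lemma bf_suml (I : Type) (r : seq I) (P : pred I) (f : I -> 'rV[R]_n) y :
  bf (\sum_(i <- r | P i) f i) y = \sum_(i <- r | P i) bf (f i) y.
Proof.
elim/big_rec2: _ => [|i u v _ <-]; last by rewrite bfDl.
by rewrite /bf !mul0mx mxE.
Qed.
Lemma bf_sumr (I : Type) (r : seq I) (P : pred I) (f : I -> 'rV[R]_n) y :
  bf y (\sum_(i <- r | P i) f i) = \sum_(i <- r | P i) bf y (f i).
Proof. by rewrite bfC bf_suml; apply: eq_bigr => i _; rewrite bfC. Qed.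

Lemma bf_delta x i : bf x (delta_mx 0 i) = (x *m B) 0 i.
Proof. by rewrite /bf trmx_delta -colE mxE. Qed.

Lemma bf_delta2 i j : bf (delta_mx 0 i) (delta_mx 0 j) = B i j.
Proof. by rewrite bf_delta -rowE mxE. Qed.

Definition refl a : 'M[R]_n := 1%:M - (2%:R *: (B *m a^T *m a)).

Lemma mul_refl x a : x *m refl a = x - (2%:R * bf x a) *: a.
Proof.
rewrite /refl mulmxBr mulmx1 -scalemxAr !mulmxA.
by rewrite [x *m B *m a^T]mx11_scalar mul_scalar_mx scalerA.
Qed.

Lemma reflK a : bf a a = 1 -> refl a *m refl a = 1%:M.
Proof.
move=> a1; apply/row_matrixP => i; rewrite !rowE mulmx1 mulmxA.
rewrite mul_refl (mul_refl (delta_mx 0 i)) bfDl bfNl bfZl a1 -!addrA -opprD -scalerDl.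
have -> : 2 * bf (delta_mx 0 i) a +
  2 * (bf (delta_mx 0 i) a - 2 * bf (delta_mx 0 i) a * 1) = 0 by ring.
by rewrite scale0r subr0.
Qed.

Lemma bf_refl x y a : bf a a = 1 -> bf (x *m refl a) (y *m refl a) = bf x y.
Proof.
move=> a1; rewrite !mul_refl !(bfDl, bfDr, bfNl, bfNr, bfZl, bfZr) a1 (bfC a y).
by ring.
Qed.

Lemma refl_self a : bf a a = 1 -> a *m refl a = - a.
Proof. by move=> a1; rewrite mul_refl a1 mulr1 scaler_nat opprD addrA subrr sub0r. Qed.

Fixpoint altmx (P Q : 'M[R]_n) k : 'M[R]_n :=
  if k is k'.+1 then P *m altmx Q P k' else 1%:M.

Lemma altmx_double P Q k : (P *m Q) ^+ k = altmx P Q k.*2.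
Proof. by elim: k => // k IH; rewrite exprS IH doubleS /= mulmxA. Qed.

End Form.

Section Rotation.
Local Open Scope ring_scope.
Variables (R : realType) (n : nat) (B : 'M[R]_n).
Hypothesis symB : B^T = B.
Variable m : nat.
Hypothesis m2 : (2 <= m)%N.

Let th : R := pi / m%:R.

(** The Chebyshev polynomial of the second kind of degree k - 1 at [cos th]; these values are the
    coefficients of roots in the plane of a dihedral group of order 2m. *)
Definition rot_coef k : R := sin (k%:R * th) / sin th.
Local Notation U := rot_coef.

Let m_gt0 : 0 < m%:R :> R. Proof. by rewrite ltr0n; lia. Qed.

Lemma sin_th_gt0 : 0 < sin th.
Proof.
apply: sin_gt0_pi; rewrite divr_gt0 ?pi_gt0 //= ltr_pdivrMr //.
by rewrite ltr_pMr ?pi_gt0 // ltr1n.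
Qed.

Lemma rot_coef0 : U 0 = 0.
Proof. by rewrite /rot_coef mul0r sin0 mul0r. Qed.

Lemma rot_coef1 : U 1 = 1.
Proof. by rewrite /rot_coef mul1r divff // gt_eqF // sin_th_gt0. Qed.

Lemma rot_coefSS k : U k.+2 = 2 * cos th * U k.+1 - U k.
Proof.
have -> : U k.+2 = sin (k.+1%:R * th + th) / sin th.
  by rewrite /rot_coef -[k.+2]addn1 natrD mulrDl mul1r.
have -> : U k = sin (k.+1%:R * th - th) / sin th.
  by rewrite /rot_coef -[k.+1]addn1 natrD mulrDl mul1r addrK.
by rewrite sinB sinD /rot_coef; ring.
Qed.

Lemma rot_coef_ge0 k : (k <= m)%N -> 0 <= U k.
Proof.
move=> km; rewrite divr_ge0 // ?(ltW sin_th_gt0) //.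
apply: sin_ge0_pi; rewrite mulr_ge0 ?divr_ge0 ?pi_ge0 ?(ltW m_gt0) //=.
rewrite mulrCA -[leRHS]mulr1 ler_wpM2l ?pi_ge0 // ler_pdivrMr // mul1r ler_nat //.
Qed.

Let mth : m%:R * th = pi.
Proof. by rewrite /th mulrCA divff ?mulr1 // gt_eqF. Qed.

Lemma rot_coef_period k : U (m + k) = - U k.
Proof. by rewrite /rot_coef natrD mulrDl mth addrC sinDpi mulNr. Qed.

Lemma altmx_formula a b k :
    bf B a a = 1 -> bf B b b = 1 -> bf B a b = - cos th ->
  a *m altmx (refl B b) (refl B a) k =
    if odd k then U k *: a + U k.+1 *: b else U k.+1 *: a + U k *: b.
Proof.
move: a b; have [j] := ubnP k; elim: j k => // j IH [|[|k]] kj a b a1 b1 ab.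
- by rewrite /= mulmx1 rot_coef1 rot_coef0 scale1r scale0r addr0.
- rewrite /= mulmx1 mul_refl ab rot_coefSS rot_coef1 rot_coef0 scale1r; congr (_ + _).
  by rewrite -scaleNr; congr (_ *: _); ring.
have ba : bf B b a = - cos th by rewrite bfC.
rewrite /= mulmxA mul_refl ab mulmxBl mulmxA refl_self // mulNmx -scalemxAl.
have -> : refl B a *m altmx (refl B b) (refl B a) k = altmx (refl B a) (refl B b) k.+1.
  by [].
rewrite (IH k.+1) // IH //; last by lia.
rewrite (rot_coefSS k.+1) (rot_coefSS k) /= negbK.
by case: ifP => _; apply/rowP => i; rewrite !mxE; ring.
Qed.

(** The product is a rotation by 2 pi / m in the plane of a and b and the identity on its orthogonal
    complement, so it is enough to test a, b and the vectors orthogonal to both. *)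
Lemma refl_mul_order a b :
    bf B a a = 1 -> bf B b b = 1 -> bf B a b = - cos th ->
  (refl B a *m refl B b) ^+ m = 1%:M.
Proof.
move=> a1 b1 ab; have ba : bf B b a = - cos th by rewrite bfC.
set P := _ *m _.
have Um k : U (m.*2 + k) = U k by rewrite -addnn -addnA !rot_coef_period opprK.
have U2m : U m.*2 = 0 by rewrite -[m.*2]addn0 Um rot_coef0.
have U2m1 : U m.*2.+1 = 1 by rewrite -addn1 Um rot_coef1.
have fixb : b *m P ^+ m = b.
  by rewrite altmx_double altmx_formula // odd_double U2m U2m1 scale1r scale0r addr0.
have fixa : a *m P ^+ m = a.
  have [k kE] : exists k, m.*2 = k.+2 by exists m.*2.-2; lia.
  have oddk : odd k = false by rewrite -[odd k]negbK -[~~ ~~ _]/(odd k.+2) -kE odd_double.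
  have := rot_coefSS k.+1; rewrite -kE U2m U2m1 mulr0 sub0r => U1.
  rewrite altmx_double kE /= mulmxA refl_self // mulNmx.
  rewrite -[_ *m altmx _ _ _]/(altmx (refl B b) (refl B a) k.+1).
  by rewrite altmx_formula //= oddk -kE U2m scale0r addr0 -scaleNr -U1 scale1r.
have fixo q : bf B q a = 0 -> bf B q b = 0 -> q *m P ^+ m = q.
  move=> qa qb; have qP : q *m P = q.
    by rewrite mulmxA !mul_refl qa mulr0 scale0r subr0 qb mulr0 scale0r subr0.
  by elim: m => [|k IH]; rewrite ?mulmx1 // exprS mulmxA qP.
have sin2 : sin th ^+ 2 != 0 by rewrite sqrf_eq0 gt_eqF // sin_th_gt0.
have := cos2Dsin2 th => cs.
apply/row_matrixP => i; rewrite !rowE mulmx1; move: (delta_mx 0 i) => x.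
(* The component of x in the plane of a and b solves a 2 by 2 system with Gram determinant
   [sin th ^+ 2]. *)
pose c1 := (bf B x a + cos th * bf B x b) / sin th ^+ 2.
pose c2 := (bf B x b + cos th * bf B x a) / sin th ^+ 2.
have -> : x = (x - (c1 *: a + c2 *: b)) + (c1 *: a + c2 *: b) by rewrite subrK.
rewrite mulmxDl fixo; last first.
- rewrite bfDl bfNl bfDl !bfZl ab b1 /c1 /c2 sin2cos2; field.
  by rewrite -sin2cos2.
- rewrite bfDl bfNl bfDl !bfZl ba a1 /c1 /c2 sin2cos2; field.
  by rewrite -sin2cos2.
by rewrite mulmxDl -!scalemxAl fixa fixb.
Qed.

End Rotation.

(** * A positive eigenvector by minimization *)

Section MinimizeForm.
Local Open Scope ring_scope.
Import classical_sets topology normedtype derive numFieldNormedType.Exports.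
Local Open Scope classical_set_scope.
Variables (R : realType) (n : nat).

Lemma continuous_sumr (T : topologicalType) (I : Type) (s : seq I) (f : I -> T -> R) :
  (forall i, continuous (f i)) -> continuous (fun x => \sum_(i <- s) f i x).
Proof.
move=> cf; elim: s => [|i s IH] x.
  under eq_fun do rewrite big_nil; exact: cst_continuous.
under eq_fun do rewrite big_cons; exact: continuousD (cf i x) (IH x).
Qed.

Lemma bf_continuous (B : 'M[R]_n) : continuous (fun x : 'rV[R]_n => bf B x x).
Proof.
have -> : (fun x : 'rV[R]_n => bf B x x) =
    fun x => \sum_(j <- index_enum 'I_n) \sum_(i <- index_enum 'I_n) x 0 i * B i j * x 0 j.
  apply: funext => x; rewrite /bf mxE; apply: eq_bigr => j _.
  by rewrite !mxE mulr_suml.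
apply: continuous_sumr => j; apply: continuous_sumr => i x.
have c1 := @coord_continuous R 1 n 0 i x; have c2 := @coord_continuous R 1 n 0 j x.
exact: (continuousM (continuousM c1 (@cst_continuous _ _ (B i j) x)) c2).
Qed.

Lemma bf1 (x : 'rV[R]_n) : bf 1%:M x x = \sum_i x 0 i ^+ 2.
Proof. by rewrite /bf mulmx1 mxE; apply: eq_bigr => i _; rewrite mxE. Qed.

(** The form attains its minimum on the compact unit sphere, and homogeneity carries the bound to
    all vectors. *)
Lemma bf_min (B : 'M[R]_n) : B^T = B -> (0 < n)%N -> exists2 x0 : 'rV[R]_n,
  bf 1%:M x0 x0 = 1 & forall x, bf 1%:M x x * bf B x0 x0 <= bf B x x.
Proof.
move=> symB n0; pose K : set 'rV[R]_n := [set x | bf 1%:M x x = 1].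
have K0 : K !=set0.
  exists (delta_mx 0 (Ordinal n0)); rewrite /K /= bf1 (bigD1 (Ordinal n0)) //=.
  rewrite mxE !eqxx expr1n big1 ?addr0 // => i /negPf ne.
  by rewrite mxE ne andbF expr0n.
have cK : compact K.
  apply: (@subclosed_compact _ _
    [set v : 'rV[R]_n | forall i, v ord0 i \in `[(- 1 : R), 1]%R]).
  - rewrite (_ : K = (fun x : 'rV[R]_n => bf 1%:M x x) @^-1` [set y | y = 1]) //.
    apply: closed_comp; last exact: closed_eq.
    by move=> x _; apply: bf_continuous.
  - apply: (@rV_compact _ _ (fun=> `[(- 1 : R), 1]%classic)) => _.
    exact: segment_compact.
  - move=> x; rewrite /K /= bf1 => x1 i; rewrite in_itv /= -ler_norml.
    rewrite -(@ler_pXn2r _ 2) ?nnegrE // expr1n real_normK ?num_real // -x1.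
    rewrite (bigD1 i) //= lerDl; apply: sumr_ge0 => j _; exact: sqr_ge0.
have [x0] := compact_EVT_min K0 cK (continuous_subspaceT (@bf_continuous B)).
rewrite inE => x01 minx; exists x0 => // x.
have [->|x_neq0] := eqVneq x 0; first by rewrite /bf !mul0mx !mxE mul0r.
have N0 : 0 < bf 1%:M x x.
  have /rV0Pn[i xi] := x_neq0; rewrite bf1 (bigD1 i) //= ltr_pwDl ?exprn_even_gt0 //.
  by apply: sumr_ge0 => j _; rewrite sqr_ge0.
have s0 : 0 < Num.sqrt (bf 1%:M x x) by rewrite sqrtr_gt0.
have sym1 : (1%:M : 'M[R]_n)^T = 1%:M by rewrite trmx1.
have := minx ((Num.sqrt (bf 1%:M x x))^-1 *: x).
have e M : M^T = M -> bf M ((Num.sqrt (bf 1%:M x x))^-1 *: x)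
    ((Num.sqrt (bf 1%:M x x))^-1 *: x) = bf M x x / bf 1%:M x x.
  move=> symM; rewrite bfZl bfZr // mulrA -invfM -expr2 sqr_sqrtr ?ltW // mulrC.
  by [].
rewrite inE /K /= !e // divff ?gt_eqF // => /(_ erefl).
by rewrite ler_pdivlMr // mulrC.
Qed.

End MinimizeForm.

Section Perron.
Local Open Scope ring_scope.
Variables (R : realType) (n : nat) (B : 'M[R]_n).
Hypotheses (symB : B^T = B) (n0 : (0 < n)%N).
Hypothesis off_diag : forall i j, i != j -> B i j <= 0.
Hypothesis connB : forall P : 'I_n -> Prop,
  (forall i j, B i j < 0 -> P i -> P j) -> forall i j, P i -> P j.

(* A vector minimizing the Rayleigh quotient may be replaced by its entrywise absolute
   value, which is then an eigenvector; connectedness excludes zero entries. *)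
Lemma perron : exists mu, exists2 v : 'rV[R]_n, (forall i, 0 < v 0 i) & v *m B = mu *: v.
Proof.
have [x0 x01 minx] := bf_min symB n0; set mu := bf B x0 x0 in minx.
pose v : 'rV[R]_n := \row_i `|x0 0 i|.
have v_ge0 i : 0 <= v 0 i by rewrite mxE.
have sym1 : (1%:M : 'M[R]_n)^T = 1%:M by rewrite trmx1.
have v1 : bf 1%:M v v = 1.
  rewrite bf1 -[RHS]x01 bf1; apply: eq_bigr => i _.
  by rewrite mxE real_normK ?num_real.
have vmu : bf B v v = mu.
  (* Passing to absolute values leaves the diagonal terms alone and can only lower the others, whose
     coefficients are nonpositive. *)
  apply/eqP; rewrite eq_le; apply/andP; split; last by have := minx v; rewrite v1 mul1r.
  rewrite /mu /bf !mxE; apply: ler_sum => j _; rewrite !mxE !mulr_suml.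
  apply: ler_sum => i _; rewrite !mxE; have [->|ij] := eqVneq i j.
    by rewrite mulrAC -normrM mulrAC -expr2 ger0_norm ?sqr_ge0.
  rewrite mulrAC [leRHS]mulrAC -normrM ler_wnM2r ?off_diag //; exact: ler_norm.
have orth y : bf B v y = mu * bf 1%:M v y.
  apply/eqP; rewrite -subr_eq0; apply/eqP.
  set d := _ - _; set q := bf B y y - mu * bf 1%:M y y.
  have q0 : 0 <= q by rewrite subr_ge0 mulrC.
  have ge0 e : 0 <= 2 * e * d + e ^+ 2 * q.
    have := minx (v + e *: y); rewrite !(bfDl, bfDr, bfZl, bfZr) // vmu v1.
    rewrite (bfC symB y v) (bfC sym1 y v) /d /q; lra.
  (* First variation: the value e = -d / (q + 1) would make the expression negative unless d = 0.
     The shift by 1 is there because q may vanish. *)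
  apply/eqP; apply: contraT => d0; have := ge0 (- d / (q + 1)).
  have q1 : 0 < q + 1 by lra.
  have -> : 2 * (- d / (q + 1)) * d + (- d / (q + 1)) ^+ 2 * q =
     - (d ^+ 2 * (q + 2) / (q + 1) ^+ 2) by field; rewrite gt_eqF.
  rewrite oppr_ge0 leNgt => /negP; case; apply: divr_gt0; last exact: exprn_gt0.
  by apply: mulr_gt0; [rewrite exprn_even_gt0|lra].
have vB : v *m B = mu *: v.
  apply/rowP => i; have := orth (delta_mx 0 i).
  by rewrite !bf_delta mulmx1 => ->; rewrite [RHS]mxE.
exists mu, v => // i; rewrite lt_def v_ge0 andbT; apply/negP => /eqP vi.
(* If v vanishes at i, row i of the eigenvector equation is a vanishing sum of terms of one sign, so
   v vanishes at the neighbours of i as well. *)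
have zero j : v 0 j = 0.
  apply: (connB (P := fun j => v 0 j = 0)) vi => {}i {}j ij vi.
  have := congr1 (fun M : 'rV_n => M 0 i) vB; rewrite mxE [RHS]mxE vi mulr0.
  move/eqP; rewrite (_ : \sum_k _ = - \sum_(k | k != i) - (v 0 k * B k i)); last first.
    by rewrite (bigD1 i) //= vi mul0r add0r sumrN opprK.
  have [->//|ji] := eqVneq j i.
  rewrite oppr_eq0 psumr_eq0 => [/allP/(_ j)|k ki]; last first.
    by rewrite oppr_ge0 mulr_ge0_le0 // off_diag.
  rewrite mem_index_enum => /(_ isT)/implyP/(_ ji).
  rewrite oppr_eq0 mulf_eq0 => /orP[/eqP//|/eqP B0].
  by move: ij; rewrite -symB mxE B0 ltxx.
have := v1; rewrite bf1 big1 ?(@eq_sym _ 0) => [/eqP|k _]; last by rewrite zero expr0n.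
by rewrite eq_sym oner_eq0.
Qed.

End Perron.

(** * The Chebyshev recursion and its first zero *)

Section Chebyshev.
Local Open Scope ring_scope.
Variables (R : realFieldType) (lam : R).

(** For lam = 2 cos t this is sin (k t) / sin t; the recursion is used because lam is not known to
    be of that form. *)
Fixpoint cheb (k : nat) : R :=
  if k is k1.+1 then if k1 is k2.+1 then lam * cheb k1 - cheb k2 else 1 else 0.

Lemma chebSS k : cheb k.+2 = lam * cheb k.+1 - cheb k. Proof. by []. Qed.

(** A quadratic form conserved by the recursion; next to a zero it leaves only the values 1 and
    -1. *)
Lemma cheb_norm k : cheb k.+1 ^+ 2 - lam * cheb k * cheb k.+1 + cheb k ^+ 2 = 1.
Proof. by elim: k => [|k IH]; [rewrite /=; ring|rewrite -IH chebSS; ring]. Qed.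

Hypothesis coherent : forall k,
  (0 <= cheb k /\ 0 <= cheb k.+1) \/ (cheb k <= 0 /\ cheb k.+1 <= 0).
Hypothesis cheb_zero : exists2 k, (2 <= k)%N & cheb k = 0.

(** At the first index from 2 on where the value is not positive, its predecessor is positive, so
    [coherent] forces the value 0. The conserved form then makes the next value -1, and the sequence
    restarts with opposite sign. *)
Lemma cheb_first_zero : exists m, [/\ (2 <= m)%N, forall k, (0 < k < m)%N -> 0 < cheb k
  & forall k, cheb (m + k) = - cheb k].
Proof.
have ex : exists k, (2 <= k)%N && (cheb k <= 0).
  by have [k k2 k0] := cheb_zero; exists k; rewrite k2 k0 lexx.
case: (ex_minnP ex) => m /andP[m2 m_le0] min_m.
have pos k : (0 < k < m)%N -> 0 < cheb k.
  case/andP; case: k => // -[|k] _ km; first exact: ltr01.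
  by rewrite ltNge; apply/negP => k0; have := min_m k.+2; rewrite k0 => /(_ isT); lia.
case: m m2 m_le0 min_m pos => // -[//|m] m2 m_le0 min_m pos.
have m1 : 0 < cheb m.+1 by apply: pos; rewrite /=.
have m0 : cheb m.+2 = 0.
  by apply/eqP; rewrite eq_le m_le0 andTb; case: (coherent m.+1) => -[]; lra.
have m3 : cheb m.+3 = -1.
  have e : cheb m.+3 = - cheb m.+1 by rewrite chebSS m0; ring.
  have := cheb_norm m.+2; rewrite m0 mulr0 mul0r subr0 expr0n addr0 => /eqP.
  by rewrite sqrf_eq1 => /orP[]/eqP //; lra.
exists m.+2; split=> // k.
suff [] : cheb (m.+2 + k) = - cheb k /\ cheb (m.+2 + k.+1) = - cheb k.+1 by [].
elim: k => [|k [IH1 IH2]]; first by rewrite addn0 addn1 m0 m3 /= oppr0.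
by split=> //; rewrite !addnS chebSS -!addnS IH2 IH1 chebSS; ring.
Qed.

End Chebyshev.

Section Cosines.
Local Open Scope ring_scope.
Variable R : realType.

(** By the triple angle formula, cos (3x) = -1 becomes (cos x + 1) (2 cos x - 1)^2 = 0, and the
    first factor is positive here. *)
Lemma cos_pi_third : cos (pi / 3) = 1 / 2 :> R.
Proof.
set x := pi / 3; have x3 : pi = x + (x + x) by rewrite /x; lra.
have c0 : 0 <= cos x.
  by apply: cos_ge0_pihalf; have := pi_gt0 R; rewrite /x; lra.
have : cos (x + (x + x)) = -1 by rewrite -x3 cospi.
rewrite !cosD !sinD => e.
have : (cos x + 1) * (2 * cos x - 1) ^+ 2 = 0.
  have s2 := sin2cos2 x; rewrite expr2 in s2.
  have e1 : 4 * cos x ^+ 3 - 3 * cos x = -1.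
    rewrite -e; have -> : cos x * (cos x * cos x - sin x * sin x)
      - sin x * (sin x * cos x + cos x * sin x) =
      cos x ^+ 3 - 3 * cos x * (sin x * sin x) by ring.
    by rewrite s2; ring.
  have -> : (cos x + 1) * (2 * cos x - 1) ^+ 2 = 4 * cos x ^+ 3 - 3 * cos x + 1 by ring.
  by rewrite e1 addNr.
move/eqP; rewrite mulf_eq0 sqrf_eq0 => /orP[|] /eqP; lra.
Qed.

Lemma cos_pi_div_ge0 m : (2 <= m)%N -> 0 <= cos (pi / m%:R) :> R.
Proof.
move=> m2; have m0 : 0 < m%:R :> R by rewrite ltr0n; lia.
have : pi / m%:R <= pi / 2 :> R.
  by rewrite ler_wpM2l ?pi_ge0 // lef_pV2 ?posrE // ler_nat.
have : 0 <= pi / m%:R :> R by rewrite divr_ge0 ?pi_ge0 ?ltW.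
by move=> *; apply: cos_ge0_pihalf; have := pi_gt0 R; lra.
Qed.

Lemma cos_pi_div_ge_half m : (3 <= m)%N -> 1 / 2 <= cos (pi / m%:R) :> R.
Proof.
move=> m2; have m0 : 0 < m%:R :> R by rewrite ltr0n; lia.
have le3 : pi / m%:R <= pi / 3 :> R.
  by rewrite ler_wpM2l ?pi_ge0 // lef_pV2 ?posrE // ler_nat.
have ge0 : 0 <= pi / m%:R :> R by rewrite divr_ge0 ?pi_ge0 ?ltW.
have pi0 := pi_gt0 R.
move: le3; rewrite le_eqVlt => /orP[/eqP-> |lt3]; first by rewrite cos_pi_third.
rewrite -cos_pi_third ltW // ltr_cos // in_itv /=; apply/andP; split; lra.
Qed.

End Cosines.

(** * The geometric representation *)

Section Geometric.
Local Open Scope ring_scope.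
Variables (R : realType) (gT : finGroupType) (n : nat) (g : 'I_n -> gT).

Definition nnv (x : 'rV[R]_n) : Prop := forall i, 0 <= x 0 i.

(** When the [g i] are involutions, the order on the diagonal is 1 and -cos pi = 1: simple roots are
    unit vectors. *)
Definition gram : 'M[R]_n := \matrix_(i, j) - cos (pi / #[g i * g j]%g%:R).

Definition sroot (i : 'I_n) : 'rV[R]_n := delta_mx 0 i.

Definition geom_rep (W : {group gT}) (rho : gT -> 'M[R]_n) :=
  [/\ {in W &, forall x y, rho (x * y)%g = rho x *m rho y},
      rho 1%g = 1%:M & forall i, rho (g i) = refl gram (sroot i)].

Lemma gram_sym : gram^T = gram.
Proof.
apply/matrixP => i j; rewrite !mxE; congr (- cos (pi / _%:R)).
by rewrite -(orderJ (g j * g i)%g (g j)) conjgE -!mulgA mulKg.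
Qed.

Lemma bf_sroot i j : bf gram (sroot i) (sroot j) = - cos (pi / #[g i * g j]%g%:R).
Proof. by rewrite bf_delta2 mxE. Qed.

End Geometric.

Record geom_datum (R : realType) (gT : finGroupType) (W : {group gT}) (S : {set gT})
    (n : nat) (g : 'I_n -> gT) (rho : gT -> 'M[R]_n) : Prop := GeomDatum {
  gd_cox : coxeter_system W S;
  gd_inj : injective g;
  gd_im : forall s, s \in S <-> exists i, s = g i;
  gd_rep : geom_rep g W rho }.

Section GeometricRepresentation.
Local Open Scope ring_scope.
Variables (R : realType) (gT : finGroupType) (W : {group gT}) (S : {set gT}).
Hypothesis hWS : coxeter_system W S.
Variables (n : nat) (g : 'I_n -> gT).
Hypotheses (g_inj : injective g) (g_im : forall s, s \in S <-> exists i, s = g i).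

Notation B := (gram R g).
Notation al := (sroot R (n:=n)).

Lemma g_in i : g i \in S. Proof. by apply/g_im; exists i. Qed.
Lemma g_inW i : g i \in W. Proof. exact: (cox_sub hWS (g_in i)). Qed.
Lemma g_sq i : (g i * g i = 1)%g. Proof. exact: (cox_invol hWS (g_in i)). Qed.

Lemma sroot1 i : bf B (al i) (al i) = 1.
Proof. by rewrite bf_sroot g_sq order1 divr1 cospi opprK. Qed.

Lemma order_ge2 i j : i != j -> (2 <= #[g i * g j]%g)%N.
Proof.
move=> ij; rewrite ltn_neqAle order_gt0 andbT eq_sym order_eq1.
apply/eqP => gg; move/eqP: ij; apply; apply: g_inj.
by apply: (mulIg (g j)); rewrite gg g_sq.
Qed.

Lemma ex_geom_rep : exists rho : gT -> 'M[R]_n, geom_rep g W rho.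
Proof.
pose idx (s : gT) : option 'I_n := [pick i | g i == s].
have idxE i : idx (g i) = Some i.
  rewrite /idx; case: pickP => [j /eqP/g_inj-> //|/(_ i)]; by rewrite eqxx.
pose M s := if idx s is Some i then refl B (al i) else 1%:M.
have [| |rho [rhoM rho1 rhoS]] := coxeter_mxrep (M := M) hWS.
- by move=> s /g_im[i ->]; rewrite /M idxE reflK // sroot1.
- move=> s t /g_im[i ->] /g_im[j ->]; rewrite /M !idxE.
  have [->|ij] := eqVneq i j.
    by rewrite g_sq order1 expr1 reflK // sroot1.
  apply: refl_mul_order; rewrite ?sroot1 ?bf_sroot //; first exact: gram_sym.
  exact: order_ge2.
by exists rho; split=> // i; rewrite rhoS ?g_in // /M idxE.
Qed.

End GeometricRepresentation.

Lemma ex_geom_datum (R : realType) (gT : finGroupType) (W : {group gT}) (S : {set gT}) :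
  coxeter_system W S -> exists rho : gT -> 'M[R]_#|S|, geom_datum W S (@enum_val _ (mem S)) rho.
Proof.
move=> hWS; have im s : s \in S <-> exists i : 'I_#|S|, s = enum_val i.
  by split=> [Ss|[i ->]]; [exists (enum_rank_in Ss s); rewrite enum_rankK_in|apply: enum_valP].
have [rho hrho] := ex_geom_rep R hWS (@enum_val_inj _ (mem S)) im.
by exists rho; split=> //; apply: enum_val_inj.
Qed.

(** * Roots and their signs *)

Section Roots.
Local Open Scope ring_scope.
Variables (R : realType) (gT : finGroupType) (W : {group gT}) (S : {set gT}).
Variables (n : nat) (g : 'I_n -> gT) (rho : gT -> 'M[R]_n).
Hypothesis gd : geom_datum W S g rho.

Notation B := (gram R g).
Notation al := (sroot R (n:=n)).

Lemma gd_in i : g i \in S. Proof. exact (g_in (gd_im gd) i). Qed.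
Lemma gd_inW i : g i \in W. Proof. exact (g_inW (gd_cox gd) (gd_im gd) i). Qed.
Lemma gd_sq i : (g i * g i)%g = 1%g. Proof. exact (g_sq (gd_cox gd) (gd_im gd) i). Qed.
Lemma gd_inv i : (g i)^-1%g = g i. Proof. by apply/eqP; rewrite eq_invg_mul gd_sq. Qed.
Lemma gd_sroot1 i : bf B (al i) (al i) = 1. Proof. exact (sroot1 R (gd_cox gd) (gd_im gd) i). Qed.
Lemma gd_order_ge2 i j : i != j -> (2 <= #[g i * g j]%g)%N.
Proof. exact (@order_ge2 _ _ _ (gd_cox gd) _ _ (gd_inj gd) (gd_im gd) i j). Qed.
Lemma gd_rhoM x y : x \in W -> y \in W -> rho (x * y)%g = rho x *m rho y.
Proof. by case: (gd_rep gd) => + _ _; apply. Qed.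
Lemma gd_rho1 : rho 1%g = 1%:M. Proof. by case: (gd_rep gd). Qed.
Lemma gd_rho_g i : rho (g i) = refl B (al i). Proof. by case: (gd_rep gd). Qed.
Lemma gd_wlen_cases i w : w \in W ->
  wlen S (g i * w)%g = (wlen S w).+1 \/ wlen S w = (wlen S (g i * w)%g).+1.
Proof. exact (@cox_wlen_cases _ _ _ (gd_cox gd) _ w (gd_in i)). Qed.
Lemma gd_peel w : w \in W -> w != 1%g ->
  exists i w', [/\ w' \in W, w = (g i * w')%g & wlen S w = (wlen S w').+1].
Proof.
move=> Ww w1; have [s [w' [/(gd_im gd)[i ->] ? ? ?]]] := cox_peel (gd_cox gd) Ww w1.
by exists i, w'.
Qed.

Lemma gd_ind (P : gT -> Prop) :
  P 1%g -> (forall i w, w \in W -> P w -> P (g i * w)%g) -> forall w, w \in W -> P w.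
Proof.
move=> P1 PM w; have [k] := ubnP (wlen S w); elim: k w => // k IH w lt_k Ww.
have [->//|/(gd_peel Ww)[i [w' [Ww' wE lenE]]]] := eqVneq w 1%g.
by rewrite wE; apply: PM => //; apply: IH => //; rewrite -ltnS -lenE.
Qed.

Lemma gd_rhoK x : x \in W -> rho x *m rho x^-1 = 1%:M.
Proof. by move=> Wx; rewrite -gd_rhoM ?groupV // mulgV gd_rho1. Qed.
Lemma gd_rhoVK x : x \in W -> rho x^-1 *m rho x = 1%:M.
Proof. by move=> Wx; rewrite -gd_rhoM ?groupV // mulVg gd_rho1. Qed.

Lemma bf_rho x y w : w \in W -> bf B (x *m rho w) (y *m rho w) = bf B x y.
Proof.
move=> Ww; move: w Ww x y; apply: gd_ind => [|i w Ww IH] x y.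
  by rewrite gd_rho1 !mulmx1.
rewrite gd_rhoM ?gd_inW // !mulmxA IH gd_rho_g bf_refl ?gd_sroot1 //.
exact: gram_sym.
Qed.

Lemma rho_altg i j k : rho (altg (g i) (g j) k) =
  altmx (refl B (al i)) (refl B (al j)) k.
Proof.
elim: k i j => [|k IH] i j /=; first by rewrite gd_rho1.
have altW: altg (g j) (g i) k \in W.
  by elim: {IH} k i j => //= k IH i j; rewrite groupM ?gd_inW.
by rewrite gd_rhoM ?gd_inW // gd_rho_g IH.
Qed.

Lemma nnvD (x y : 'rV[R]_n) : nnv x -> nnv y -> nnv (x + y).
Proof. by move=> x0 y0 i; rewrite mxE addr_ge0. Qed.
Lemma nnvZ (k : R) (x : 'rV[R]_n) : 0 <= k -> nnv x -> nnv (k *: x).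
Proof. by move=> k0 x0 i; rewrite mxE mulr_ge0. Qed.

(* Write w as an alternating word u in g j, g i, of maximal length and beginning with
   g j, followed by v of length wlen w - |u|; then v lengthens under both g i and g j. *)
Lemma tits_nonneg w i : w \in W -> (wlen S w < wlen S (g i * w)%g)%N ->
  nnv (al i *m rho w).
Proof.
have [k] := ubnP (wlen S w); elim: k w i => // k IH w i lt_k Ww iw.
have [->|w1] := eqVneq w 1%g.
  by rewrite gd_rho1 mulmx1 => l; rewrite mxE; case: (_ && _).
have [s [w' [/(gd_im gd)[j ->] Ww' wE lenE]]] := cox_peel (gd_cox gd) Ww w1.
have ij : i != j.
  apply/eqP => ij; move: iw; rewrite ij {2}wE mulgA gd_sq mul1g lenE; lia.
pose split_at u := exists v, [/\ v \in W, w = altg (g j) (g i) u * v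
   & wlen S w = u + wlen S v]%g%N.
have split1 : `[< split_at 1 >].
  by apply/asboolP; exists w'; rewrite /= mulg1 -wE lenE add1n.
have split_bd u : `[< split_at u >] -> (u <= wlen S w)%N.
  by move=> /asboolP[v [_ _ ->]]; apply: leq_addr.
have split_ex : exists u, `[< split_at u >] by exists 1%N.
case: (ex_maxnP split_ex split_bd) => u /asboolP[v [Wv wuv lenuv]] umax.
have u1 : (0 < u)%N by apply: umax.
have SW x : x \in W -> x \in <<S>>%g by rewrite (cox_gen (gd_cox gd)).
have altW a b l : altg (g a) (g b) l \in W.
  by elim: l a b => //= l IHl a b; rewrite groupM ?gd_inW.
have len_alt a b l x : x \in W -> (wlen S (altg (g a) (g b) l * x)%g <= l + wlen S x)%N.
  move=> Wx; have [r rw szr] := word_for_altg l (gd_in a) (gd_in b).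
  apply: leq_trans (wlen_mul (SW _ (altW _ _ _)) (SW _ Wx)) _.
  by rewrite leq_add2r -[X in (_ <= X)%N]szr wlen_le.
(* The next letter of the alternating word cannot shorten v, because u is maximal. *)
have up_next : wlen S ((if odd u then g i else g j) * v)%g = (wlen S v).+1.
  set y := (if _ then _ else _).
  have Sy : y \in S by rewrite /y; case: ifP; rewrite gd_in.
  case: (cox_wlen_cases (gd_cox gd) Sy Wv) => // lenv.
  have Wyv : (y * v)%g \in W by rewrite groupM // (cox_sub (gd_cox gd) Sy).
  suff : (u.+1 <= u)%N by rewrite ltnn.
  apply: umax; apply/asboolP; exists (y * v)%g; split=> //.
  - rewrite -addn1 altg_add wuv -!mulgA; congr (_ * _)%g.
    rewrite (_ : (if odd u then _ else _) = y); last by rewrite /y; case: ifP; rewrite /= mulg1.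
    by rewrite mulgA (cox_invol (gd_cox gd) Sy) mul1g.
  - by rewrite lenuv lenv addSnnS.
(* The last letter of the alternating word cannot shorten v either: absorbing it into v would give w
   a word that is too short. *)
have up_last : wlen S ((if odd u then g j else g i) * v)%g = (wlen S v).+1.
  set y := (if _ then _ else _).
  have Sy : y \in S by rewrite /y; case: ifP; rewrite gd_in.
  have Wyv : (y * v)%g \in W by rewrite groupM // (cox_sub (gd_cox gd) Sy).
  case: (cox_wlen_cases (gd_cox gd) Sy Wv) => // lenv.
  have wE' : w = (altg (g j) (g i) u.-1 * (y * v))%g.
    rewrite wuv -{1}(prednK u1) -[u.-1.+1]addn1 altg_add -!mulgA; congr (_ * (_ * _))%g.
    by rewrite /y -{2}(prednK u1) /=; case: (odd u.-1); rewrite /= mulg1.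
  have := len_alt j i u.-1 (y * v)%g Wyv; rewrite -wE' lenuv lenv.
  by move: (wlen S (y * v)%g) => a; lia.
have [upi upj] : wlen S (g i * v)%g = (wlen S v).+1 /\ wlen S (g j * v)%g = (wlen S v).+1.
  by move: up_next up_last; case: ifP.
have lt_v : (wlen S v < k)%N by move: lt_k; rewrite lenuv; lia.
have nni : nnv (al i *m rho v) by apply: IH; rewrite ?upi.
have nnj : nnv (al j *m rho v) by apply: IH; rewrite ?upj.
(* Otherwise the braid relation would make the alternating word begin with [g i], and [g i] would
   shorten w. Strictness matters: the coefficients of index u and u + 1 must both be nonnegative. *)
have lt_um : (u < #[g j * g i]%g)%N.
  rewrite ltnNge; apply/negP => le_mu; set m := #[_]%g in le_mu.
  have uE : u = (m + (u - m))%N by rewrite subnKC.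
  have m_gt0 : (0 < m)%N by rewrite order_gt0.
  have wE' : (g i * w = altg (g j) (g i) m.-1 *
      ((if odd m then altg (g i) (g j) (u - m) else altg (g j) (g i) (u - m)) * v))%g.
    rewrite wuv {1}uE altg_add; set x := (if _ then _ else _).
    have -> : altg (g j) (g i) m = (g i * altg (g j) (g i) m.-1)%g.
      by rewrite altg_swap ?gd_sq // -/m -{1}(prednK m_gt0).
    by rewrite !mulgA gd_sq mul1g.
  have Wx : (if odd m then altg (g i) (g j) (u - m) else altg (g j) (g i) (u - m))%g \in W.
    by case: ifP.
  have := len_alt j i m.-1 _ (groupM Wx Wv); rewrite -wE'.
  have lenx : (wlen S ((if odd m then altg (g i) (g j) (u - m)
       else altg (g j) (g i) (u - m)) * v)%g <= (u - m) + wlen S v)%N.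
    by case: ifP => _; apply: len_alt.
  by move: iw; rewrite lenuv; lia.
rewrite wuv gd_rhoM // rho_altg mulmxA (@altmx_formula _ _ _ _ #[g j * g i]%g).
- have ge0 l : (l <= #[g j * g i]%g)%N -> 0 <= rot_coef R #[g j * g i]%g l.
    by apply: rot_coef_ge0; apply: gd_order_ge2; rewrite eq_sym.
  by case: ifP => _; rewrite mulmxDl -!scalemxAl; apply: nnvD; apply: nnvZ => //;
     apply: ge0; rewrite ?(ltnW lt_um).
- exact: gram_sym.
- by apply: gd_order_ge2; rewrite eq_sym.
- exact: gd_sroot1.
- exact: gd_sroot1.
- by rewrite (bfC (gram_sym _ _)) bf_sroot.
Qed.

Definition isroot (b : 'rV[R]_n) := exists i, exists2 w, w \in W & b = al i *m rho w.

Lemma isroot_rho b w : isroot b -> w \in W -> isroot (b *m rho w).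
Proof.
move=> [i [v Wv ->]] Ww; exists i, (v * w)%g; first by rewrite groupM.
by rewrite gd_rhoM // mulmxA.
Qed.

Lemma isroot_sroot i : isroot (al i).
Proof. by exists i, 1%g; rewrite ?group1 // gd_rho1 mulmx1. Qed.

Lemma isroot1 b : isroot b -> bf B b b = 1.
Proof. by move=> [i [w Ww ->]]; rewrite bf_rho // gd_sroot1. Qed.

Lemma isrootN b : isroot b -> isroot (- b).
Proof.
move=> [i [w Ww ->]]; exists i, (g i * w)%g; first by rewrite groupM ?gd_inW.
by rewrite gd_rhoM ?gd_inW // gd_rho_g mulmxA refl_self ?gd_sroot1 // mulNmx.
Qed.

Lemma isroot_sign b : isroot b -> nnv b \/ nnv (- b).
Proof.
move=> [i [w Ww ->]]; case: (gd_wlen_cases i Ww) => len.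
  by left; apply: tits_nonneg; rewrite // len.
right; have Wgw : (g i * w)%g \in W by rewrite groupM ?gd_inW.
have -> : - (al i *m rho w) = al i *m rho (g i * w)%g.
  by rewrite gd_rhoM ?gd_inW // gd_rho_g mulmxA refl_self ?gd_sroot1 // mulNmx.
by apply: tits_nonneg => //; rewrite mulgA gd_sq mul1g len.
Qed.

Lemma isroot_neq0 b : isroot b -> b <> 0.
Proof.
move=> /isroot1 + b0; rewrite b0 /bf !mul0mx mxE => /eqP.
by rewrite eq_sym oner_eq0.
Qed.

Lemma isroot_nnvN b : isroot b -> nnv b -> ~ nnv (- b).
Proof.
move=> rb b0 b0'; apply: (isroot_neq0 rb); apply/rowP => i.
by apply/eqP; rewrite mxE eq_le b0 -oppr_ge0; have := b0' i; rewrite mxE => ->.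
Qed.

Lemma descent w : w \in W -> w != 1%g -> exists i w',
  [/\ w' \in W, w = (g i * w')%g, wlen S w = (wlen S w').+1 & nnv (- (al i *m rho w))].
Proof.
move=> Ww /(gd_peel Ww)[i [w' [Ww' wE lenE]]]; exists i, w'; split=> //.
rewrite wE gd_rhoM ?gd_inW // gd_rho_g mulmxA refl_self ?gd_sroot1 // mulNmx opprK.
by apply: tits_nonneg => //; rewrite -wE lenE.
Qed.

Lemma nnv_eq1 w : w \in W -> (forall i, nnv (al i *m rho w)) -> w = 1%g.
Proof.
move=> Ww pos; apply/eqP/negP => /negP/(descent Ww)[i [_ [_ _ _ neg]]].
by apply: isroot_nnvN (pos i) neg; apply: isroot_rho => //; apply: isroot_sroot.
Qed.

Lemma row_sroot (x : 'rV[R]_n) : x = \sum_i x 0 i *: al i.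
Proof. exact: row_sum_delta. Qed.

(** If x and y act alike, then [x * y^-1] keeps every simple root positive, which excludes a left
    descent. *)
Lemma rho_inj : {in W &, injective rho}.
Proof.
move=> x y Wx Wy eq_xy; apply/eqP; rewrite eq_mulgV1; apply/eqP.
apply: nnv_eq1 => [|i j]; first by rewrite groupM ?groupV.
rewrite gd_rhoM ?groupV // eq_xy gd_rhoK // mulmx1 mxE; by case: (_ && _).
Qed.

(** The reflection alters only the coordinate i, so the other coordinates of b have both signs and
    vanish; unit length does the rest. *)
Lemma simple_flip b i : isroot b -> nnv b -> nnv (- (b *m rho (g i))) -> b = al i.
Proof.
move=> rb b0; rewrite gd_rho_g mul_refl => bs0.
have bj j : j != i -> b 0 j = 0.
  move=> ji; apply/eqP; rewrite eq_le b0 andbT -oppr_ge0; move: (bs0 j).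
  by rewrite !mxE (negPf ji) andbF mulr0 subr0.
have bE : b = b 0 i *: al i.
  apply/rowP => j; rewrite !mxE /=; have [->|ji] := eqVneq j i; first by rewrite mulr1.
  by rewrite bj // mulr0.
have := isroot1 rb; rewrite bE bfZl bfZr ?gram_sym // gd_sroot1 mulr1.
move/eqP; rewrite -expr2 sqrf_eq1 => /orP[]/eqP b1; first by rewrite b1 scale1r.
by have := b0 i; rewrite b1 oppr_ge0 ler10.
Qed.

Lemma rho_conj i w : w \in W -> rho (g i ^ w)%g = refl B (al i *m rho w).
Proof.
move=> Ww; apply/row_matrixP => k; rewrite !rowE; set x := delta_mx 0 k.
have xE : x = (x *m rho w^-1) *m rho w by rewrite -mulmxA gd_rhoVK // mulmx1.
rewrite conjgE !gd_rhoM ?groupM ?groupV ?gd_inW // !mulmxA gd_rho_g mul_refl.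
rewrite [RHS]mul_refl {3 4}xE bf_rho // mulmxBl -scalemxAl.
by rewrite -[x *m _ *m _]xE.
Qed.

Lemma refl_eq a b : isroot a -> isroot b -> refl B a = refl B b -> a = b \/ a = - b.
Proof.
move=> ra rb eq_ab; have := refl_self (isroot1 ra); rewrite eq_ab mul_refl.
move=> /(congr1 (fun z => a - z)); rewrite opprK opprB addrC subrK => e.
have {e}aE : a = bf B a b *: b.
  apply: (scalerI (a := 2)); rewrite ?pnatr_eq0 // scalerA e scaler_nat mulr2n //.
have := isroot1 ra; rewrite {2}aE bfZr ?gram_sym // => /eqP.
rewrite -expr2 sqrf_eq1 => /orP[]/eqP ab1; rewrite aE ab1 ?scale1r ?scaleN1r; tauto.
Qed.

Lemma gram_le0 i j : i != j -> B i j <= 0.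
Proof. by move=> ij; rewrite mxE oppr_le0 cos_pi_div_ge0 // gd_order_ge2. Qed.

Lemma gram_edge i j : (3 <= #[g i * g j]%g)%N -> B i j <= - (1 / 2).
Proof. by move=> ij; rewrite mxE lerN2 cos_pi_div_ge_half. Qed.

Lemma gram_commute i j : i != j -> (#[g i * g j]%g < 3)%N -> B i j = 0.
Proof.
move=> /gd_order_ge2 ge2; rewrite ltnS => le2; rewrite mxE.
by rewrite (_ : #[_]%g = 2%N) ?cos_pihalf ?oppr0 //; apply/eqP; rewrite eqn_leq le2.
Qed.

End Roots.

(** * Positive definiteness of the Gram form, and the diagram as a forest *)

Section Irreducible.
Local Open Scope ring_scope.
Variables (R : realType) (gT : finGroupType) (W : {group gT}) (S : {set gT}).
Variables (n : nat) (g : 'I_n -> gT) (rho : gT -> 'M[R]_n).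
Hypothesis gd : geom_datum W S g rho.
Hypothesis hirr : coxeter_irreducible S.

Notation B := (gram R g).
Notation al := (sroot R (n:=n)).

Lemma irr_ind (P : 'I_n -> Prop) :
    (forall i j, (3 <= #[g i * g j]%g)%N -> P i -> P j) ->
  forall i j, P i -> P j.
Proof.
move=> stepP i j Pi; have [_ /(_ _ _ (gd_in gd i) (gd_in gd j))] := hirr.
case/connectP => p; elim: p i Pi => [|s p IH] i Pi /=.
  by move=> _ /(gd_inj gd)->.
move=> /andP[/and3P[_ /(gd_im gd)[k ->] ik] pp] lastp.
exact: IH (stepP _ _ ik Pi) pp lastp.
Qed.

(* The average of the standard inner product over W is invariant, hence a multiple of
   the Gram form on each connected component of the diagram. *)
Lemma gram_pos_def x : x != 0 -> 0 < bf B x x.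
Proof.
pose A : 'M[R]_n := \sum_(w in W) rho w *m (rho w)^T.
have bfA y z : bf A y z = \sum_(w in W) ((y *m rho w) *m (z *m rho w)^T) 0 0.
  rewrite /bf mulmx_sumr mulmx_suml summxE; apply: eq_bigr => w _.
  by rewrite trmx_mul !mulmxA.
have symA : A^T = A.
  by rewrite /A linear_sum /=; apply: eq_bigr => w _; rewrite trmx_mul trmxK.
have dot_gt0 (y : 'rV[R]_n) : y != 0 -> 0 < (y *m y^T) 0 0.
  move=> y0; rewrite mxE lt_def; apply/andP; split; last first.
    by apply: sumr_ge0 => i _; rewrite mxE -expr2 sqr_ge0.
  apply/eqP => /eqP; rewrite psumr_eq0; last by move=> i _; rewrite mxE -expr2 sqr_ge0.
  move=> /allP e; move/eqP: y0; apply; apply/rowP => i; rewrite mxE.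
  have := e i; rewrite mem_index_enum => /(_ isT); rewrite mxE -expr2 sqrf_eq0.
  by move/eqP.
have A_gt0 y : y != 0 -> 0 < bf A y y.
  move=> y0; rewrite bfA (bigD1 1%g) ?group1 //= (gd_rho1 gd) !mulmx1.
  rewrite ltr_wpDr ?dot_gt0 //; apply: sumr_ge0 => w _.
  by have [->|/dot_gt0/ltW//] := eqVneq (y *m rho w) 0; rewrite mul0mx mxE.
have A_inv i y z : bf A (y *m rho (g i)) (z *m rho (g i)) = bf A y z.
  have Wg := gd_inW gd i.
  rewrite !bfA [RHS](reindex_inj (mulgI (g i))) /=.
  apply: eq_big => [w|w Ww]; first by rewrite groupMl.
  by rewrite !(gd_rhoM gd) // !mulmxA.
pose k i := bf A (al i) (al i).
have al_neq0 i : al i != 0.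
  apply/eqP => /(congr1 (fun M : 'rV_n => M 0 i)); rewrite !mxE !eqxx.
  by move/eqP; rewrite oner_eq0.
have k_gt0 i : 0 < k i by apply: A_gt0.
(* The part z of y that is B-orthogonal to [al i] is fixed by [g i], which negates [al i];
   invariance of [A] makes the two A-orthogonal. *)
have bfAal i y : bf A y (al i) = bf B y (al i) * k i.
  pose z := y - bf B y (al i) *: al i.
  have zfix : z *m rho (g i) = z.
    rewrite (gd_rho_g gd) mul_refl /z bfDl bfNl bfZl (gd_sroot1 gd) mulr1 subrr.
    by rewrite mulr0 scale0r subr0.
  have z0 : bf A z (al i) = 0.
    have := A_inv i z (al i); rewrite zfix (gd_rho_g gd) refl_self ?(gd_sroot1 gd) //.
    by rewrite bfNr //; lra.
  by rewrite -[y](subrK (bf B y (al i) *: al i)) bfDl bfZl z0 add0r -/(k i) subrK.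
(* Evaluate [A] on two adjacent simple roots in both orders and cancel their nonzero B-product. *)
have k_const i j : k i = k j.
  apply: (irr_ind (P := fun j => k i = k j)) (erefl _) => {}j l jl ->.
  have := bfAal j (al l); rewrite (bfC symA) bfAal (bfC (gram_sym _ _)).
  have := gram_edge R jl; rewrite -bf_delta2 -/(sroot _ _) => jl0 e.
  apply/esym; apply: mulfI e; apply/eqP => e0.
  by move: jl0; rewrite (bfC (gram_sym _ _)) e0; lra.
move=> x0; have [i _] : exists i, x 0 i != 0.
  by have /rV0Pn := x0.
have : bf A x x = bf B x x * k i.
  rewrite {2}[x]row_sroot {4}[x]row_sroot !bf_sumr ?gram_sym // mulr_suml.
  apply: eq_bigr => j _; rewrite !bfZr ?gram_sym // bfAal (k_const j i); ring.
by move=> e; have := A_gt0 _ x0; rewrite e pmulr_lgt0.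
Qed.

Lemma gram_nondeg x : (forall i, bf B x (al i) = 0) -> x = 0.
Proof.
move=> x0; apply/eqP/negP => /negP/gram_pos_def.
rewrite {2}[x]row_sroot bf_sumr ?gram_sym // big1 ?ltxx // => i _.
by rewrite bfZr ?gram_sym // x0 mulr0.
Qed.

(** If every vertex of [J] had two neighbours in [J], the sum x of the simple roots of [J] would
    have B(x, x) <= 0: each row contributes 1 from the diagonal and at most -1/2 from each of two
    edges. *)
Lemma diagram_forest (J : {set 'I_n}) : J != set0 ->
  exists2 i, i \in J & (#|[set j in J | (j != i) && (3 <= #[g i * g j]%g)%N]| <= 1)%N.
Proof.
move=> J0; apply: contrapT => noleaf.
have many i : i \in J ->
    (2 <= #|[set j in J | (j != i) && (3 <= #[g i * g j]%g)%N]|)%N.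
  by move=> Ji; rewrite ltnNge; apply/negP => le1; apply: noleaf; exists i.
pose x : 'rV[R]_n := \sum_(i in J) al i.
have x0 : x != 0.
  case/set0Pn: J0 => i Ji; apply/eqP => /(congr1 (fun M : 'rV_n => M 0 i)).
  rewrite summxE (bigD1 i) //= !mxE !eqxx big1 => [|j /andP[_ /negPf ji]].
    by move/eqP; rewrite addr0 oner_eq0.
  by rewrite mxE [_ == j]eq_sym ji andbF.
have := gram_pos_def x0; rewrite ltNge => /negP; apply.
rewrite {1}/x bf_suml; apply: sumr_le0 => i Ji; rewrite bf_sumr ?gram_sym //.
rewrite (bigD1 i) //= (gd_sroot1 gd).
have := many i Ji; set E := [set j in J | _] => cardE.
rewrite (bigID (fun j => j \in E)) /=.
have le_half : \sum_(j | ((j \in J) && (j != i)) && (j \in E)) bf B (al i) (al j) <= -1.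
  have -> : -1 = - (1 / 2) *+ 2 :> R by rewrite mulr2n; lra.
  apply: (@le_trans _ _ (\sum_(j in E) - (1 / 2))); last first.
    by rewrite sumr_const; apply: ler_wnMn2l => //; lra.
  rewrite (eq_bigl (fun j => j \in E)).
    apply: ler_sum => j; rewrite inE => /and3P[_ _ ij].
    by rewrite bf_delta2; apply: gram_edge.
  by move=> j; rewrite !inE; case: (j \in J); case: (j != i).
have le0 : \sum_(j | ((j \in J) && (j != i)) && (j \notin E)) bf B (al i) (al j) <= 0.
  apply: sumr_le0 => j /andP[/andP[_ ji] _]; rewrite bf_delta2 (gram_le0 gd) // eq_sym //.
by move: le_half le0; lra.
Qed.

End Irreducible.

(** * Conjugacy of Coxeter elements *)

Section CoxeterElements.
Local Open Scope group_scope.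
Variables (R : realType) (gT : finGroupType) (W : {group gT}) (S : {set gT}).
Variables (n : nat) (g : 'I_n -> gT) (rho : gT -> 'M[R]_n).
Hypothesis gd : geom_datum W S g rho.
Hypothesis hirr : coxeter_irreducible S.

Definition adj : rel 'I_n := fun i j => 3 <= #[g i * g j].
Definition word_prod (r : seq 'I_n) : gT := \prod_(i <- r) g i.
Local Notation wordg := word_prod.

Lemma adjC : symmetric adj.
Proof.
by move=> i j; rewrite /adj -(orderJ (g i * g j) (g i)) conjgE -!mulgA mulKg.
Qed.

Lemma adj_forest (J : {set 'I_n}) : J != set0 ->
  exists2 i, i \in J & #|[set j in J | (j != i) && adj i j]| <= 1.
Proof. exact (@diagram_forest _ _ _ _ _ _ _ gd hirr J). Qed.

Lemma nadj_commute i j : ~~ adj i j -> g i * g j = g j * g i.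
Proof.
rewrite /adj -ltnNge ltnS => le2; have [->//|ij] := eqVneq i j.
have := expg_order (g i * g j).
have -> : #[g i * g j] = 2 by apply/eqP; rewrite eqn_leq le2 (gd_order_ge2 gd).
rewrite expgS expg1 => e; apply: (mulgI (g i * g j)); rewrite e.
by rewrite mulgA -(mulgA (g i)) (gd_sq gd) mulg1 (gd_sq gd).
Qed.

Lemma wordg_cat a b : wordg (a ++ b) = wordg a * wordg b.
Proof. exact: big_cat. Qed.
Lemma wordg_cons i r : wordg (i :: r) = g i * wordg r.
Proof. exact: big_cons. Qed.
Lemma wordg_rcons r i : wordg (rcons r i) = wordg r * g i.
Proof. by rewrite -cats1 wordg_cat wordg_cons /word_prod big_nil mulg1. Qed.
Lemma wordg_in (H : {group gT}) r : {in r, forall i, g i \in H} -> wordg r \in H.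
Proof. by move=> rH; rewrite /word_prod big_seq group_prod. Qed.
Lemma wordgW r : wordg r \in W.
Proof. by apply: wordg_in => i _; apply: gd_inW gd i. Qed.

(** The conjugating element stays in [H] so that the same statement serves [W] and its parabolic
    subgroups. *)
Lemma cyc_eq_conj (H : {group gT}) r1 r2 : cyc_eq adj r1 r2 ->
  {in r1, forall i, g i \in H} -> exists2 w, w \in H & wordg r2 = wordg r1 ^ w.
Proof.
elim=> {r1 r2} [r|r1 r2 e12 IH|r1 r2 r3 e12 IH1 _ IH2|i r|a i j b ij] rH.
- by exists 1; rewrite ?group1 ?conjg1.
- have [|w Hw ->] := IH; first by move=> i; rewrite (perm_mem (cyc_eq_perm e12)); apply: rH.
  by exists w^-1; rewrite ?groupV // conjgK.
- have [w Hw e1] := IH1 rH; have [|v Hv ->] := IH2.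
    by move=> i; rewrite -(perm_mem (cyc_eq_perm e12)); apply: rH.
  by exists (w * v); rewrite ?groupM // conjgM e1.
- exists (g i); first by rewrite rH ?mem_head.
  by rewrite wordg_rcons wordg_cons conjgE -!mulgA mulKg.
- exists 1; rewrite ?group1 // conjg1 !wordg_cat !wordg_cons; congr (_ * _).
  by rewrite !mulgA (nadj_commute ij).
Qed.

Lemma coxeter_words_conj (H : {group gT}) r1 r2 : uniq r1 -> uniq r2 -> r1 =i r2 ->
  {in r1, forall i, g i \in H} -> exists2 w, w \in H & wordg r2 = wordg r1 ^ w.
Proof.
by move=> u1 u2 e12; apply/cyc_eq_conj/cyc_eq_arrangements; [apply: adjC|apply: adj_forest|..].
Qed.

Lemma coxeter_element_word (A : {set gT}) c : A \subset S -> coxeter_element A c ->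
  exists r, [/\ uniq r, forall i, (i \in r) = (g i \in A) & c = wordg r].
Proof.
move=> /fintype.subsetP AS [r0 [u0 r0A ->]].
have [r r0E] : exists r, r0 = map g r.
  have : {subset r0 <= S} by move=> s; rewrite r0A => /AS.
  elim: r0 {u0 r0A} => [|s r0 IH] sub; first by exists [::].
  have [|r ->] := IH; first by move=> t r0t; rewrite sub // inE r0t orbT.
  have /(gd_im gd)[i ->] : s \in S by rewrite sub ?mem_head.
  by exists (i :: r).
exists r; split; first by move: u0; rewrite r0E (map_inj_uniq (gd_inj gd)).
  by move=> i; rewrite -r0A r0E (mem_map (gd_inj gd)).
by rewrite r0E big_map.
Qed.

End CoxeterElements.

(** * Parabolic subgroups *)

Section Parabolic.
Local Open Scope ring_scope.
Variables (R : realType) (gT : finGroupType) (W : {group gT}) (S : {set gT}).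
Variables (n : nat) (g : 'I_n -> gT) (rho : gT -> 'M[R]_n).
Hypothesis gd : geom_datum W S g rho.
Hypothesis hirr : coxeter_irreducible S.

Notation B := (gram R g).
Notation al := (sroot R (n:=n)).
Notation T := (reflections W S).
Notation wordg := (word_prod g).

Lemma reflectionsP t : reflect (exists i, exists2 w, w \in W & t = (g i ^ w)%g) (t \in T).
Proof.
apply: (iffP imset2P) => [[s w /(gd_im gd)[i ->] Ww ->]|[i [w Ww ->]]].
  by exists i, w.
by exists (g i) w; rewrite ?(gd_in gd).
Qed.

Lemma reflections_sub : T \subset W.
Proof.
by apply/fintype.subsetP => _ /reflectionsP[i [w Ww ->]]; rewrite groupJ ?(gd_inW gd).
Qed.

Lemma reflection_root t : t \in T ->
  exists b, [/\ isroot W rho b, nnv b & rho t = refl B b].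
Proof.
move=> /reflectionsP[i [w Ww ->]]; rewrite (rho_conj gd) //.
have rb : isroot W rho (al i *m rho w) by apply: (isroot_rho gd) => //; apply: (isroot_sroot gd).
have [pos|neg] := isroot_sign gd rb; first by exists (al i *m rho w).
exists (- (al i *m rho w)); split=> //; first exact: (isrootN gd).
apply/row_matrixP => k; rewrite !rowE !mul_refl bfNr ?gram_sym //.
by rewrite mulrN scaleNr scalerN !opprK.
Qed.

Lemma mul_wordg_notin (x : 'rV[R]_n) r j : j \notin r -> (x *m rho (wordg r)) 0 j = x 0 j.
Proof.
elim: r x => [|i r IH] x; first by rewrite /word_prod big_nil (gd_rho1 gd) mulmx1.
rewrite inE negb_or => /andP[ji jr]; rewrite wordg_cons (gd_rhoM gd) ?(gd_inW gd) ?(wordgW gd) //.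
by rewrite mulmxA IH // (gd_rho_g gd) mul_refl !mxE (negPf ji) andbF mulr0 subr0.
Qed.

(** The letters are distinct, so the coordinate i is changed only by the first letter, namely by -2
    B(x, al i); for a fixed vector this is 0. *)
Lemma wordg_fix_orth (x : 'rV[R]_n) r : uniq r -> x *m rho (wordg r) = x ->
  {in r, forall i, bf B x (al i) = 0}.
Proof.
elim: r => //= i r IH /andP[ir ur].
rewrite wordg_cons (gd_rhoM gd) ?(gd_inW gd) ?(wordgW gd) // mulmxA (gd_rho_g gd) => fx.
have xi : bf B x (al i) = 0.
  have := congr1 (fun M : 'rV_n => M 0 i) fx.
  by rewrite /= mul_wordg_notin // mul_refl !mxE !eqxx mulr1; lra.
move: fx; rewrite mul_refl xi mulr0 scale0r subr0 => /(IH ur) orth j.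
by rewrite inE => /orP[/eqP->|/orth].
Qed.

Lemma exists_orth (bs : seq 'rV[R]_n) : (size bs < n)%N ->
  exists2 x : 'rV[R]_n, x != 0 & {in bs, forall b, bf B x b = 0}.
Proof.
move=> lt_bs; pose M : 'M[R]_(n, size bs) := \matrix_(i, k) (B *m (nth 0 bs k)^T) i 0.
have /rowV0Pn[x /sub_kermxP xM x0] : kermx M != 0.
  by rewrite -mxrank_eq0 mxrank_ker -lt0n subn_gt0 (leq_ltn_trans (rank_leq_col M)).
exists x => // b /(nthP 0)[k lt_k <-].
have := congr1 (fun N : 'rV_(size bs) => N 0 (Ordinal lt_k)) xM; rewrite !mxE => <-.
by rewrite /bf -mulmxA mxE; apply: eq_bigr => j _; rewrite [in RHS]mxE.
Qed.

Lemma orth_fix (r : seq gT) : {subset r <= T} -> exists bs : seq 'rV[R]_n,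
  [/\ size bs = size r,
      forall x, {in bs, forall b, bf B x b = 0} -> x *m rho (\prod_(t <- r) t)%g = x
    & forall x, {in bs, forall b, bf B x b = 0} -> {in r, forall t, x *m rho t = x}].
Proof.
elim: r => [|t r IH] sub.
  by exists [::]; split=> // x _; rewrite big_nil (gd_rho1 gd) mulmx1.
have Tt : t \in T by rewrite sub ?mem_head.
have subr : {subset r <= T} by move=> z rz; rewrite sub // inE rz orbT.
have [bs [szbs fix1 fix2]] := IH subr; have [b [_ _ tE]] := reflection_root Tt.
have tfix x : bf B x b = 0 -> x *m rho t = x.
  by move=> xb; rewrite tE mul_refl xb mulr0 scale0r subr0.
exists (b :: bs); split=> [|x xbs|x xbs]; first by rewrite /= szbs.
  have Wr : (\prod_(z <- r) z)%g \in W.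
    by rewrite big_seq group_prod // => z /subr/(fintype.subsetP reflections_sub).
  rewrite big_cons (gd_rhoM gd) // ?(fintype.subsetP reflections_sub) //.
  rewrite mulmxA tfix ?xbs ?mem_head // fix1 // => c cbs; apply: xbs; by rewrite inE cbs orbT.
move=> z; rewrite inE => /orP[/eqP->|rz]; first by rewrite tfix ?xbs ?mem_head.
by apply: fix2 rz => c cbs; apply: xbs; rewrite inE cbs orbT.
Qed.

Lemma simple_reflection i : g i \in T.
Proof. by apply/reflectionsP; exists i, 1%g; rewrite ?group1 // conjg1. Qed.

Lemma word_for_wordg (A : {set gT}) r : {in r, forall i, g i \in A} ->
  word_for A (wordg r) (map g r).
Proof.
by move=> rA; split; [move=> _ /mapP[i /rA gi ->]|rewrite big_map].
Qed.

(** Fewer than n reflections fix a common nonzero vector, orthogonal to their roots, whereas a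
    Coxeter element fixes only 0. *)
Lemma wlen_coxeter r : uniq r -> (forall i, i \in r) -> wlen T (wordg r) = n.
Proof.
move=> ur allr; have szr : size r = n.
  rewrite -(card_uniqP ur) -[RHS]card_ord; apply: eq_card => i; by rewrite allr.
have wr : word_for T (wordg r) (map g r).
  by apply: word_for_wordg => i _; apply: simple_reflection.
have le_n : (wlen T (wordg r) <= n)%N.
  by have := wlen_le wr; rewrite size_map szr.
apply/eqP; rewrite eqn_leq le_n /= leqNgt.
apply/negP => lt_n; have [q [sub pq] szq] := wlen_word (word_for_gen wr).
have [bs [szbs fix1 _]] := orth_fix sub.
have [|x x0 xbs] := @exists_orth bs; first by rewrite szbs szq.
have := fix1 x xbs; rewrite pq => /(wordg_fix_orth ur) orth.
by move/eqP: x0; apply; apply: (gram_nondeg gd hirr) => i; rewrite orth.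
Qed.

Lemma gram_unit : B \in unitmx.
Proof.
rewrite -row_free_unit -kermx_eq0; apply/eqP/row_matrixP => i; rewrite row0.
apply: (gram_nondeg gd hirr) => j; rewrite bf_delta.
have /sub_kermxP-> : (row i (kermx B) <= kermx B)%MS by apply: row_sub.
by rewrite mxE.
Qed.

(** The fundamental weights, dual to the simple roots for the form [B]. *)
Definition fweight i : 'rV[R]_n := delta_mx 0 i *m invmx B.

Lemma bf_fweight i (x : 'rV[R]_n) : bf B (fweight i) x = x 0 i.
Proof. by rewrite /bf /fweight mulmxKV ?gram_unit // -rowE !mxE. Qed.

(** Pairing with the weight reads off the coordinate i. If w fixes the weight, [al i *m rho w] has
    coordinate 1 there and stays positive; so every left descent j of w differs from i, [g j] fixes
    the weight, and induction applies to [g j * w]. *)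
Lemma fweight_stab i w : w \in W -> fweight i *m rho w = fweight i ->
  w \in <<S :\ g i>>%g.
Proof.
have [k] := ubnP (wlen S w); elim: k w => // k IH w lt_k Ww fixw.
have [->|/(descent gd Ww)[j [w' [Ww' wE lenE neg]]]] := eqVneq w 1%g; first exact: group1.
have ij : i != j.
  apply/eqP => ij; have := neg i.
  rewrite mxE -(bf_fweight i) -{1}fixw (bf_rho gd) // bf_fweight ij !mxE !eqxx.
  by rewrite oppr_ge0 ler10.
rewrite wE; apply: groupM.
  by rewrite mem_gen // !inE (gd_in gd) andbT (inj_eq (gd_inj gd)) eq_sym.
apply: IH => //; first by rewrite -ltnS -lenE.
have -> : w' = (g j * w)%g by rewrite wE mulgA (gd_sq gd) mul1g.
rewrite (gd_rhoM gd) ?(gd_inW gd) // mulmxA (gd_rho_g gd) mul_refl bf_fweight.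
by rewrite mxE (negPf ij) andbF mulr0 scale0r subr0.
Qed.

(** A simple reflection turns only its own root negative; consider the first letter at which the
    sign changes. *)
Lemma root_flip b r : isroot W rho b -> nnv b -> nnv (- (b *m rho (wordg r))) ->
  exists r1 j r2, r = r1 ++ j :: r2 /\ b *m rho (wordg r1) = al j.
Proof.
move=> rb; elim: r b rb => [|i r IH] b rb pos.
  by rewrite /word_prod big_nil (gd_rho1 gd) mulmx1 => /(isroot_nnvN gd rb pos).
have rbi : isroot W rho (b *m rho (g i)) by apply: (isroot_rho gd); rewrite ?(gd_inW gd).
rewrite wordg_cons (gd_rhoM gd) ?(gd_inW gd) ?(wordgW gd) // mulmxA => neg.
have [pos'|/(simple_flip gd rb pos)->] := isroot_sign gd rbi; last first.
  by exists [::], i, r; split; rewrite // /word_prod big_nil (gd_rho1 gd) mulmx1.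
have [r1 [j [r2 [-> e]]]] := IH _ rbi pos' neg.
exists (i :: r1), j, r2; split=> //.
by rewrite wordg_cons (gd_rhoM gd) ?(gd_inW gd) ?(wordgW gd) // mulmxA.
Qed.

Lemma gen_wordg (A : {set gT}) w : A \subset S -> w \in <<A>>%g ->
  exists2 r, w = wordg r & {in r, forall i, g i \in A}.
Proof.
move=> /fintype.subsetP AS /gen_word_for[q]; elim: q w => [|s q IH] w.
  by move=> [_ <-]; exists [::]; rewrite // /word_prod !big_nil.
move=> /word_for_uncons[As /IH[r wE rA]].
have /(gd_im gd)[i sE] := AS s As; exists (i :: r).
  by rewrite wordg_cons -wE -sE mulKVg.
by move=> j; rewrite inE => /orP[/eqP->|/rA//]; rewrite -sE.
Qed.

Notation WJ i := (parabolic S (g i)).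
Notation TJ i := (reflections (WJ i) (S :\ g i)).

Lemma parabolic_sub i : WJ i \subset W.
Proof.
rewrite gen_subG; apply/fintype.subsetP => s /setD1P[_].
by move=> /(gd_im gd)[j ->]; apply: (gd_inW gd).
Qed.

Lemma parabolic_reflections_sub i : TJ i \subset T.
Proof.
apply/fintype.subsetP => _ /imset2P[s w /setD1P[_ /(gd_im gd)[j ->]] Ww ->].
by apply/reflectionsP; exists j, w => //; apply: (fintype.subsetP (parabolic_sub i)).
Qed.

(** A reflection negates its own root. Along a word for t in the parabolic generators the sign flips
    at a simple root, which exhibits t as a conjugate of that generator inside the subgroup. *)
Lemma parabolic_reflections i t : t \in T -> t \in WJ i -> t \in TJ i.
Proof.
move=> Tt Wt; have [b [rb pos tE]] := reflection_root Tt.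
have [r rE rA] := gen_wordg (subsetDl S [set g i]) Wt.
have [|r1 [j [r2 [r12 bE]]]] := root_flip rb pos (r := r).
  by rewrite -rE tE refl_self ?opprK // (isroot1 gd).
have Wr1 := wordgW gd r1; have WJr1 : (wordg r1) \in WJ i.
  by apply: wordg_in => k kr; rewrite mem_gen ?rA // r12 mem_cat kr.
have Sj : g j \in S :\ g i by rewrite rA // r12 mem_cat mem_head orbT.
apply/imset2P; exists (g j) (wordg r1)^-1%g; rewrite ?groupV //.
apply: (rho_inj gd).
- exact: (fintype.subsetP reflections_sub).
- by rewrite groupJ ?groupV ?(gd_inW gd).
rewrite tE (rho_conj gd) ?groupV // -bE -mulmxA (gd_rhoK gd) // mulmx1 //.
Qed.

(** The roots of n - 1 reflections leave a nonzero orthogonal vector. The product fixes it, so it is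
    orthogonal to every simple root but [al i] and is a multiple of the weight; hence each of the
    reflections fixes the weight and lies in the parabolic subgroup. *)
Lemma facts_parabolic i r : uniq r -> (forall j, (j \in r) = (j != i)) ->
  facts T n.-1 (wordg r) = facts (TJ i) n.-1 (wordg r).
Proof.
move=> ur rE; apply/setP => q; apply/factsP/factsP => -[sub pq]; split=> //; last first.
  by move=> t /sub/(fintype.subsetP (parabolic_reflections_sub i)).
have n0 : (0 < n)%N by rewrite (leq_ltn_trans _ (ltn_ord i)).
have [bs [szbs fix1 fix2]] := orth_fix sub.
have [|x x0 xbs] := @exists_orth bs; first by rewrite szbs size_tuple ltn_predL.
have orth := wordg_fix_orth ur (etrans (congr1 (fun w => x *m rho w) (esym pq)) (fix1 x xbs)).
have xw : x = bf B x (al i) *: fweight i.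
  apply/eqP; rewrite -subr_eq0; apply/eqP; apply: (gram_nondeg gd hirr) => j.
  rewrite bfDl bfNl bfZl bf_fweight !mxE /=; have [->|ji] := eqVneq j i.
    by rewrite ?eqxx ?mulr1 subrr.
  by rewrite orth ?rE // mulr0 subr0.
move=> t qt; have Tt := sub t qt; apply: parabolic_reflections => //.
apply: fweight_stab; first exact: (fintype.subsetP reflections_sub).
have k0 : bf B x (al i) != 0.
  by apply: contraNneq x0 => k0; rewrite xw k0 scale0r.
have := fix2 x xbs t qt; rewrite xw -scalemxAl; exact: scalerI.
Qed.

Lemma reflectionsJ t w : w \in W -> t \in T -> (t ^ w)%g \in T.
Proof.
move=> Ww /reflectionsP[i [v Wv ->]]; apply/reflectionsP; exists i, (v * w)%g.
  by rewrite groupM.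
by rewrite conjgM.
Qed.

Lemma MC_coxeter c r : coxeter_element S c -> uniq r -> (forall i, i \in r) ->
  MC W S c = #|facts T n (wordg r)|.
Proof.
move=> /(coxeter_element_word gd (fintype.subxx S))[q [uq qE cE]] ur allr.
have allq i : i \in q by rewrite qE (gd_in gd).
have lenc : wlen T c = n by rewrite cE wlen_coxeter.
have Tc : c \in <<T>>%g.
  rewrite cE; apply: (word_for_gen (r := map g q)).
  by apply: word_for_wordg => i _; apply: simple_reflection.
rewrite MC_facts ?reflections_sub // lenc cE.
have [|i _|w Ww ->] := coxeter_words_conj gd hirr (H := W) ur uq.
- by move=> i; rewrite allr allq.
- exact: (gd_inW gd).
by rewrite card_factsJ // => t; apply: reflectionsJ; rewrite ?groupV.
Qed.

Lemma MC_parabolic i d r : coxeter_element (S :\ g i) d ->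
    uniq r -> (forall j, (j \in r) = (j != i)) ->
  MC (WJ i) (S :\ g i) d = #|facts T n.-1 (wordg r)|.
Proof.
move=> /(coxeter_element_word gd (subsetDl S [set g i]))[q [uq qE dE]] ur rE.
have {}qE j : (j \in q) = (j != i).
  by rewrite qE !inE (gd_in gd) andbT (inj_eq (gd_inj gd)).
have gJ j : j != i -> g j \in TJ i.
  move=> ji; apply/imset2P; exists (g j) 1%g; rewrite ?group1 ?conjg1 //.
  by rewrite !inE (gd_in gd) andbT (inj_eq (gd_inj gd)).
have wq : word_for (TJ i) d (map g q).
  by rewrite dE; apply: word_for_wordg => j; rewrite qE; apply: gJ.
have szq : size q = n.-1.
  rewrite -(card_uniqP uq) -[n in RHS]card_ord -(cardC1 i); apply: eq_card => j.
  by rewrite qE.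
have lend : wlen (TJ i) d = n.-1.
  apply/eqP; rewrite eqn_leq -{1}szq -{1}(size_map g q) wlen_le //=.
  have [q' [sub pq'] szq'] := wlen_word (word_for_gen wq).
  have wq' : word_for T d q'.
    by split=> // t /sub/(fintype.subsetP (parabolic_reflections_sub i)).
  (* Multiplying d by [g i] gives a Coxeter element of [W], of length n, so a word for d has at
     least n - 1 letters. *)
  have := wlen_le (word_for_cons (simple_reflection i) wq').
  rewrite dE -wordg_cons wlen_coxeter /= ?qE ?eqxx ?uq // => [|j].
    by rewrite szq' -dE; lia.
  by rewrite inE qE; case: (j == i).
have WJJ t w : w \in WJ i -> t \in TJ i -> (t ^ w)%g \in TJ i.
  move=> Ww /imset2P[s v Ss Wv ->]; apply/imset2P; exists s (v * w)%g => //.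
    by rewrite groupM.
  by rewrite conjgM.
rewrite MC_facts ?(word_for_gen wq) //; last first.
  apply/fintype.subsetP => _ /imset2P[s v Ss Wv ->].
  by rewrite groupJ // mem_gen.
rewrite lend dE (facts_parabolic ur rE).
have [|j|w Ww ->] := coxeter_words_conj gd hirr (H := WJ i) ur uq.
- by move=> j; rewrite rE qE.
- by rewrite rE => ji; rewrite mem_gen // !inE (gd_in gd) andbT (inj_eq (gd_inj gd)).
by rewrite card_factsJ // => t; apply: WJJ; rewrite ?groupV.
Qed.

End Parabolic.

(** * The Coxeter plane *)

Section CoxeterPlane.
Local Open Scope ring_scope.
Variables (R : realType) (gT : finGroupType) (W : {group gT}) (S : {set gT}).
Variables (n : nat) (g : 'I_n -> gT) (rho : gT -> 'M[R]_n).
Hypothesis gd : geom_datum W S g rho.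
Hypothesis hirr : coxeter_irreducible S.
Variable col : 'I_n -> bool.
Hypothesis colP : forall i j, i != j -> adj g i j -> col i != col j.
Variable i0 : 'I_n.
Hypothesis col_i0 : col i0.
Variables (mu : R) (v : 'rV[R]_n).
Hypotheses (v_gt0 : forall i, 0 < v 0 i) (v_eigen : v *m gram R g = mu *: v).

Notation B := (gram R g).
Notation al := (sroot R (n:=n)).
Notation wordg := (word_prod g).
(** 1 - mu is the eigenvalue of v for the identity minus the Gram matrix, which links only vertices
    of different colours; the 2 comes from the reflections. A posteriori lam = 2 cos (pi / h). *)
Let lam := 2 * (1 - mu).
Local Notation U := (cheb lam).

Definition color_word e := [seq i <- enum 'I_n | col i == e].
Definition bip_word := color_word true ++ color_word false.
Let c := wordg bip_word.

(* The two coordinates of the projection of x to the Coxeter plane. *)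
Definition cx (e : bool) (x : 'rV[R]_n) : R := \sum_(i | col i == e) v 0 i * x 0 i.

Lemma cxD e x y : cx e (x + y) = cx e x + cx e y.
Proof. by rewrite /cx -big_split; apply: eq_bigr => i _; rewrite mxE mulrDr. Qed.
Lemma cxN e x : cx e (- x) = - cx e x.
Proof. by rewrite /cx -sumrN; apply: eq_bigr => i _; rewrite mxE mulrN. Qed.
Lemma cx_sroot e i : cx e (al i) = if col i == e then v 0 i else 0.
Proof.
rewrite /cx; case: ifP => ei.
  rewrite (bigD1 i) //= big1 => [|j /andP[_ /negPf ji]].
    by rewrite addr0 !mxE !eqxx mulr1.
  by rewrite mxE ji andbF mulr0.
rewrite big1 // => j ej; have /negPf ji : j != i by apply: contraFneq ei => <-.
by rewrite mxE ji andbF mulr0.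
Qed.

Lemma same_color_orth i j : i != j -> col i = col j -> B i j = 0.
Proof.
move=> ij cij; apply: (gram_commute gd) => //; rewrite ltnNge; apply/negP => e.
by have := colP ij e; rewrite cij eqxx.
Qed.

(** Simple roots of one colour are orthogonal, so each letter leaves the products of x with the
    later roots unchanged. *)
Lemma mul_mono_word (q : seq 'I_n) (e : bool) (x : 'rV[R]_n) : uniq q ->
  {in q, forall i, col i = e} ->
  x *m rho (wordg q) = x - \sum_(i <- q) (2 * bf B x (al i)) *: al i.
Proof.
elim: q x => [|i q IH] x; first by rewrite /word_prod !big_nil (gd_rho1 gd) mulmx1 subr0.
move=> /= /andP[iq uq] qe.
rewrite wordg_cons (gd_rhoM gd) ?(gd_inW gd) ?(wordgW gd) // mulmxA (gd_rho_g gd).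
rewrite IH // => [|j qj]; last by rewrite qe // inE qj orbT.
rewrite mul_refl big_cons opprD addrA; congr (_ - _).
rewrite !big_seq; apply: eq_bigr => j qj; congr (_ *: _); congr (_ * _).
have ij : i != j by apply: contraNneq iq => ->.
rewrite bfDl bfNl bfZl bf_delta2 same_color_orth ?mulr0 ?subr0 //.
by rewrite !qe // inE ?eqxx // qj orbT.
Qed.

Lemma color_word_uniq e : uniq (color_word e).
Proof. by rewrite filter_uniq // enum_uniq. Qed.
Lemma mem_color_word e i : (i \in color_word e) = (col i == e).
Proof. by rewrite mem_filter mem_enum andbT. Qed.

Lemma mul_color_word e x : x *m rho (wordg (color_word e)) =
  x - \sum_(i | col i == e) (2 * bf B x (al i)) *: al i.
Proof.
rewrite (@mul_mono_word _ e) ?color_word_uniq //; last first.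
  by move=> i; rewrite mem_color_word => /eqP.
by rewrite big_filter big_enum_cond.
Qed.

Lemma cx_color_other e x : cx (~~ e) (x *m rho (wordg (color_word e))) = cx (~~ e) x.
Proof.
apply: eq_bigr => i /eqP ie; rewrite (mul_wordg_notin gd) //.
by rewrite mem_color_word ie; case: (e).
Qed.

Lemma cx_color_same e x :
  cx e (x *m rho (wordg (color_word e))) = - cx e x + lam * cx (~~ e) x.
Proof.
have coordE i : col i == e ->
    (x *m rho (wordg (color_word e))) 0 i = x 0 i - 2 * bf B x (al i).
  move=> ie; rewrite mul_color_word !mxE summxE (bigD1 i) //= big1 => [|j /andP[_ /negPf ji]].
    by rewrite !mxE !eqxx mulr1 addr0.
  by rewrite !mxE eq_sym ji andbF mulr0.
(* This is the coordinate j of the eigenvector equation without its diagonal term; the other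
   vertices coloured like j contribute nothing. *)
have eigenE j : col j == ~~ e ->
    \sum_(i | col i == e) v 0 i * B j i = (mu - 1) * v 0 j.
  move=> je; have := congr1 (fun M : 'rV_n => M 0 j) v_eigen; rewrite mxE [RHS]mxE => eqj.
  rewrite mulrBl mul1r -eqj [in RHS](bigID (fun i => col i == e)) /=.
  rewrite [X in _ = _ + X - _](bigD1 j) /=; last by rewrite (eqP je); case: (e).
  rewrite [X in _ = _ + (_ + X) - _]big1 => [|i /andP[ie ij]]; last first.
    rewrite same_color_orth ?mulr0 // (eqP je); by case: (col i) (e) ie => -[].
  have -> : B j j = 1 by rewrite -bf_delta2; apply: (gd_sroot1 gd).
  rewrite mulr1 addr0 addrK; apply: eq_bigr => i _.
  by rewrite -[in LHS](gram_sym R g) mxE.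
have bfE i : col i == e ->
    bf B x (al i) = x 0 i + \sum_(j | col j == ~~ e) x 0 j * B j i.
  move=> ie; rewrite bf_delta mxE (bigD1 i) //=.
  have -> : B i i = 1 by rewrite -bf_delta2; apply: (gd_sroot1 gd).
  rewrite mulr1; congr (_ + _); rewrite (bigID (fun j => col j == e)) /= big1 ?add0r.
    apply: eq_bigl => j; case: eqVneq => [->|_] /=; first by rewrite (eqP ie); case: (e).
    by case: (col j) (e) => -[].
  move=> j /andP[ji je]; rewrite same_color_orth ?mulr0 //.
  by rewrite (eqP je) (eqP ie).
have -> : cx e (x *m rho (wordg (color_word e))) =
    \sum_(i | col i == e) (- (v 0 i * x 0 i) +
      \sum_(j | col j == ~~ e) - (2 * x 0 j * (v 0 i * B j i))).
  apply: eq_bigr => i ie; rewrite coordE // bfE // sumrN.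
  under [in RHS]eq_bigr do rewrite -!mulrA (mulrCA _ (v 0 i)) (mulrCA 2) .
  rewrite -!mulr_sumr; ring.
rewrite big_split sumrN; congr (_ + _); rewrite exchange_big /= /cx mulr_sumr.
apply: eq_bigr => j je; rewrite sumrN -mulr_sumr eigenE // /lam; ring.
Qed.

Lemma bip_word_uniq : uniq bip_word.
Proof.
rewrite cat_uniq !color_word_uniq andbT /=; apply/hasPn => i.
by rewrite !mem_color_word => /eqP->.
Qed.

Lemma mem_bip_word i : i \in bip_word.
Proof. by rewrite mem_cat !mem_color_word; case: (col i). Qed.

Lemma bipE : rho c = rho (wordg (color_word true)) *m rho (wordg (color_word false)).
Proof. by rewrite /c wordg_cat (gd_rhoM gd) ?(wordgW gd). Qed.

Lemma cW : c \in W. Proof. exact: (wordgW gd). Qed.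

Lemma cx_c_true (x : 'rV[R]_n) : cx true (x *m rho c) = - cx true x + lam * cx false x.
Proof. by rewrite bipE mulmxA (cx_color_other false) cx_color_same. Qed.

Lemma cx_c_false (x : 'rV[R]_n) : cx false (x *m rho c) = - cx false x + lam * cx true (x *m rho c).
Proof.
rewrite cx_c_true bipE mulmxA cx_color_same (cx_color_other true); congr (_ + _ * _).
exact: cx_color_same.
Qed.

Lemma mul_cS (x : 'rV[R]_n) k : x *m rho (c ^+ k.+1)%g = x *m rho (c ^+ k)%g *m rho c.
Proof. by rewrite expgSr (gd_rhoM gd) ?groupX ?cW // mulmxA. Qed.

(** Interleaved by colour, the coordinates along an orbit form one sequence obeying the Chebyshev
    recursion; each colour class advances it by one step. *)
Lemma cx_cX (x : 'rV[R]_n) k :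
  cx true (x *m rho (c ^+ k.+1)%g) = - cx true x * U k.*2.+1 + cx false x * U k.*2.+2 /\
  cx false (x *m rho (c ^+ k.+1)%g) = - cx true x * U k.*2.+2 + cx false x * U k.*2.+3.
Proof.
elim: k => [|k [IH1 IH2]].
  rewrite expg1 cx_c_false cx_c_true /=; split; ring.
rewrite mul_cS cx_c_false cx_c_true IH1 IH2 doubleS !chebSS; split; ring.
Qed.

(** As v is positive, the two coordinates of a root share its sign and do not both vanish, so their
    sum detects it. *)
Definition sg (b : 'rV[R]_n) : bool := 0 < cx true b + cx false b.

Lemma cx_ge0 e b : nnv b -> 0 <= cx e b.
Proof. by move=> b0; apply: sumr_ge0 => i _; rewrite mulr_ge0 // ltW. Qed.

Lemma sg_nnv b : isroot W rho b -> sg b -> nnv b.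
Proof.
move=> rb sb; have [//|neg] := isroot_sign gd rb.
have := cx_ge0 true neg; have := cx_ge0 false neg; rewrite !cxN.
by move: sb; rewrite /sg; lra.
Qed.

Lemma nnv_sg b : isroot W rho b -> nnv b -> sg b.
Proof.
move=> rb b0; rewrite /sg; have [i bi] : exists i, b 0 i != 0.
  have : b != 0 by apply/eqP; apply: (isroot_neq0 gd rb).
  by move/rV0Pn.
have vb : 0 < v 0 i * b 0 i by rewrite mulr_gt0 // lt_def bi b0.
have := cx_ge0 (~~ col i) b0.
have : 0 < cx (col i) b.
  by rewrite /cx (bigD1 i) //= ltr_pwDl // sumr_ge0 // => j _; rewrite mulr_ge0 // ltW.
by case: (col i) => /=; lra.
Qed.

Lemma sgN b : isroot W rho b -> sg (- b) = ~~ sg b.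
Proof.
move=> rb; have rNb := isrootN gd rb; apply/idP/negP => [s1 s2|].
  by have := sg_nnv rNb s1; apply: (isroot_nnvN gd) => //; apply: sg_nnv.
move=> ns; apply: nnv_sg => //; have [pos|//] := isroot_sign gd rb.
by case: ns; apply: nnv_sg.
Qed.

Lemma cx_same_sign b : isroot W rho b ->
  (0 <= cx true b /\ 0 <= cx false b) \/ (cx true b <= 0 /\ cx false b <= 0).
Proof.
move=> rb; have [pos|neg] := isroot_sign gd rb; [left|right].
  by split; apply: cx_ge0.
have := cx_ge0 true neg; have := cx_ge0 false neg; rewrite !cxN; lra.
Qed.

Lemma cx_i0 : cx true (al i0) = v 0 i0 /\ cx false (al i0) = 0.
Proof. by rewrite !cx_sroot col_i0. Qed.

Lemma isroot_c b k : isroot W rho b -> isroot W rho (b *m rho (c ^+ k)%g).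
Proof. by move=> rb; apply: (isroot_rho gd) => //; rewrite groupX // cW. Qed.

(** Up to the factor [- v 0 i0], consecutive values are the two coordinates of a root in the orbit
    of [al i0]; every other pair arises at a half step, after the first colour class only. *)
Lemma cheb_coherent k : (0 <= U k /\ 0 <= U k.+1) \/ (U k <= 0 /\ U k.+1 <= 0).
Proof.
case: k => [|k]; first by left; rewrite /= ler01.
have [i1 i2] := cx_i0; have vi := v_gt0 i0.
have scale x y : (0 <= v 0 i0 * x /\ 0 <= v 0 i0 * y) \/ (v 0 i0 * x <= 0 /\ v 0 i0 * y <= 0) ->
    (0 <= x /\ 0 <= y) \/ (x <= 0 /\ y <= 0).
  by rewrite !pmulr_rge0 // !pmulr_rle0.
have [j kE] : exists j, k = j.*2 \/ k = j.*2.+1.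
  exists k./2; have := odd_double_half k; case: (odd k); rewrite ?add0n ?add1n => ->; auto.
apply: scale; have rj := isroot_c j.+1 (isroot_sroot gd i0).
have [e1 e2] := cx_cX (al i0) j; rewrite i1 i2 !mul0r !addr0 in e1 e2.
case: kE => ->.
  have := cx_same_sign rj; rewrite e1 e2; case=> -[h1 h2]; [right|left]; split; lra.
have rj' : isroot W rho (al i0 *m rho (c ^+ j.+1)%g *m rho (wordg (color_word true))).
  by apply: (isroot_rho gd) => //; apply: (wordgW gd).
have := cx_same_sign rj'; rewrite cx_color_same (cx_color_other true) [negb _]/= e1 e2.
by rewrite (chebSS lam j.*2.+1); case=> -[h1 h2]; [right|left]; split; lra.
Qed.

Lemma cheb_order_zero k : (c ^+ k.+1)%g = 1%g -> U k.+1.*2 = 0 /\ U k.+1.*2.+1 = 1.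
Proof.
move=> ck; have [i1 i2] := cx_i0; have vi := v_gt0 i0.
have [] := cx_cX (al i0) k; rewrite ck (gd_rho1 gd) mulmx1 i1 i2 !mul0r !addr0 => e1 e2.
have u0 : U k.*2.+2 = 0.
  by apply/eqP; move/eqP: e2; rewrite eq_sym mulf_eq0 oppr_eq0 gt_eqF.
have u1 : U k.*2.+1 = -1.
  have : v 0 i0 * (U k.*2.+1 + 1) = 0 by rewrite mulrDr mulr1 {2}e1; ring.
  by move/eqP; rewrite mulf_eq0 gt_eqF //= addr_eq0 => /eqP.
by rewrite doubleS; split=> //; rewrite chebSS u0 u1; ring.
Qed.

(** Let m be the first zero. The m-th power of c gives simple roots their original coordinates back,
    so it keeps them positive and is 1. Conversely U takes the values 0 and 1 at 2h and 2h + 1; if h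
    < m, then either 2h < m contradicts positivity, or these values are -U at 2h - m and 2h - m + 1,
    which cannot be 0 and 1. *)
Lemma coxeter_number_cheb : let h := #[c]%g in
  [/\ (2 <= h)%N, forall k, (0 < k < h)%N -> 0 < U k & forall k, U (h + k) = - U k].
Proof.
have h0 : (0 < #[c]%g)%N by rewrite order_gt0.
have [u0 u1] : U #[c]%g.*2 = 0 /\ U #[c]%g.*2.+1 = 1.
  by rewrite -(prednK h0); apply: cheb_order_zero; rewrite prednK // expg_order.
have [|m [m2 pos per]] := cheb_first_zero cheb_coherent.
  by exists #[c]%g.*2 => //; lia.
have um : U m = 0 by rewrite -[m]addn0 per oppr0.
have um1 : U m.+1 = -1 by rewrite -addn1 per.
have u2m : U m.*2 = 0 by rewrite -addnn per um oppr0.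
have u2m1 : U m.*2.+1 = 1 by rewrite -addnn -addnS per um1 opprK.
suff -> : #[c]%g = m by [].
have cm : (c ^+ m)%g = 1%g.
  apply: (nnv_eq1 gd); first by rewrite groupX // cW.
  move=> i; have ri := isroot_c m (isroot_sroot gd i); apply: sg_nnv => //.
  have [] := cx_cX (al i) m.-1; rewrite prednK; last by lia.
  have -> : m.-1.*2.+3 = m.*2.+1 by lia.
  have -> : m.-1.*2.+2 = m.*2 by lia.
  rewrite u2m u2m1 => e1 e2.
  have um2 : U m.-1.*2.+1 = -1.
    have := chebSS lam m.-1.*2.+1.
    have -> : m.-1.*2.+3 = m.*2.+1 by lia.
    have -> : m.-1.*2.+2 = m.*2 by lia.
    by rewrite u2m u2m1; lra.
  rewrite /sg e1 e2 um2 !cx_sroot; have := v_gt0 i.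
  by case: (col i) => /=; lra.
have /dvdnP[q mE] : (#[c]%g %| m)%N by rewrite order_dvdn cm.
have le_hm : (#[c]%g <= m)%N by rewrite dvdn_leq ?order_dvdn ?cm //; lia.
apply/eqP; rewrite eqn_leq le_hm /= leqNgt; apply/negP => lt_hm.
have [lt2|ge2] := ltnP #[c]%g.*2 m.
  have /pos : (0 < #[c]%g.*2 < m)%N by rewrite lt2 double_gt0 h0.
  by rewrite u0 ltxx.
have eqm : #[c]%g.*2 = (m + (#[c]%g.*2 - m))%N by rewrite subnKC.
move: u0 u1; rewrite eqm -addnS !per; case k0: (#[c]%g.*2 - m)%N => [|k].
  by rewrite /=; lra.
have /pos : (0 < k.+1 < m)%N by rewrite -k0 /=; lia.
by move=> uk1 uk _; lra.
Qed.

(** * Two sign changes along each orbit of roots *)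

Lemma isroot_c1 b : isroot W rho b -> isroot W rho (b *m rho c).
Proof. by move=> rb; apply: (isroot_rho gd) => //; apply: cW. Qed.

Lemma cheb_sum_sign j : (j < #[c]%g.*2)%N -> (0 < - (U j + U j.+1)) = (#[c]%g <= j)%N.
Proof.
have [h2 pos per] := coxeter_number_cheb => j2.
have ge0 k : (k < #[c]%g)%N -> 0 < U k + U k.+1.
  move=> kh; have Uk1 : 0 <= U k.+1.
    have [lt|] := ltnP k.+1 #[c]%g; first by rewrite ltW // pos.
    by move=> ge; have -> : k.+1 = (#[c]%g + 0)%N; [lia|rewrite per /= oppr0].
  case: k kh Uk1 => [|k] kh Uk1; first by rewrite /=; lra.
  by rewrite ltr_pwDl // pos.
have [le|lt] := leqP #[c]%g j; last by have := ge0 j lt; lra.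
have -> : j = (#[c]%g + (j - #[c]%g))%N by rewrite subnKC.
rewrite -addnS !per; have := ge0 (j - #[c]%g)%N; rewrite ltn_subLR //= addnn j2 => /(_ isT).
by move=> ?; apply/idP; lra.
Qed.

(** Let A and B be the coordinates of b of colour true and false. If the sign is lost in the second
    half step, A = lam B; if in the first, B = 0. Either way the later coordinates are negative
    multiples of two consecutive Chebyshev values, and the sign returns at half of h, rounded up or
    down respectively. *)
Lemma sg_after_descent b : isroot W rho b -> sg b -> ~~ sg (b *m rho c) ->
  exists2 p, (0 < p < #[c]%g)%N &
    forall k, (k < #[c]%g)%N -> sg (b *m rho (c ^+ k.+1)%g) = (p <= k)%N.
Proof.
move=> rb sb nsbc; have [h2 _ _] := coxeter_number_cheb.
have b0 := sg_nnv rb sb.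
have A0 := cx_ge0 true b0; have B0 := cx_ge0 false b0.
have rb1 : isroot W rho (b *m rho (wordg (color_word true))).
  by apply: (isroot_rho gd) => //; apply: (wordgW gd).
have := cx_color_same true b; have := cx_color_other true b; rewrite /= => eB eA.
have [pos|neg] := isroot_sign gd rb1.
  have A1 := cx_ge0 true pos; have rbc := isroot_c1 rb.
  have nbc : nnv (- (b *m rho c)).
    by apply: (sg_nnv (isrootN gd rbc)); rewrite sgN.
  have := cx_ge0 true nbc; rewrite cxN cx_c_true => A2.
  have eAB : cx true b = lam * cx false b by lra.
  have Bpos : 0 < cx false b.
    rewrite lt_def B0 andbT; apply/eqP => Be; move: sb; rewrite /sg eAB Be; lra.
  exists (uphalf #[c]%g); first by lia.
  move=> k kh; have [e1 e2] := cx_cX b k.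
  have -> : sg (b *m rho (c ^+ k.+1)%g) = (0 < - (U k.*2 + U k.*2.+1)).
    rewrite /sg e1 e2 eAB -[RHS](pmulr_rgt0 _ Bpos); congr (0 < _).
    by rewrite (chebSS lam k.*2.+1) (chebSS lam k.*2); ring.
  by rewrite cheb_sum_sign; lia.
have := cx_ge0 false neg; rewrite cxN eB => B1.
have Be : cx false b = 0 by lra.
have Apos : 0 < cx true b by move: sb; rewrite /sg Be addr0.
exists (#[c]%g./2); first by lia.
move=> k kh; have [e1 e2] := cx_cX b k.
have -> : sg (b *m rho (c ^+ k.+1)%g) = (0 < - (U k.*2.+1 + U k.*2.+2)).
  rewrite /sg e1 e2 Be -[RHS](pmulr_rgt0 _ Apos); congr (0 < _); ring.
by rewrite cheb_sum_sign; lia.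
Qed.

Lemma mul_cX_add (b : 'rV[R]_n) j k :
  b *m rho (c ^+ j)%g *m rho (c ^+ k)%g = b *m rho (c ^+ (k + j))%g.
Proof. by rewrite -mulmxA -(gd_rhoM gd) ?groupX ?cW // -expgD addnC. Qed.

(* The sum over a c-orbit is fixed by c, hence zero. *)
Lemma exists_neg_in_orbit b : isroot W rho b -> exists k, ~~ sg (b *m rho (c ^+ k)%g).
Proof.
move=> rb; apply: contrapT => noneg.
have pos k : sg (b *m rho (c ^+ k)%g).
  by apply: contrapT => /negP neg; apply: noneg; exists k.
have [h2 _ _] := coxeter_number_cheb.
pose y := \sum_(k < #[c]%g) b *m rho (c ^+ k)%g.
have yc : y *m rho c = y.
  rewrite /y mulmx_suml; case: #[c]%g (expg_order c) => [|h] ch; first by rewrite !big_ord0.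
  rewrite big_ord_recr [RHS]big_ord_recl /= addrC -mul_cS ch; congr (_ + _).
  by apply: eq_bigr => k _; rewrite -mul_cS.
have y0 : y = 0.
  apply: (gram_nondeg gd hirr) => i; apply: (wordg_fix_orth gd bip_word_uniq yc).
  exact: mem_bip_word.
have cx_y e : cx e y = \sum_(k < #[c]%g) cx e (b *m rho (c ^+ k)%g).
  rewrite /y; elim/big_rec2: _ => [|k p q _ <-]; last by rewrite cxD.
  by rewrite /cx big1 // => i _; rewrite mxE mulr0.
have cx0 e : cx e (0 : 'rV[R]_n) = 0 by rewrite /cx big1 // => i _; rewrite mxE mulr0.
have h0 : (0 < #[c]%g)%N by lia.
have : 0 < cx true y + cx false y.
  rewrite !cx_y -big_split (bigD1 (Ordinal h0)) //= ltr_pwDl //; first exact: (pos 0%N).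
  by apply: sumr_ge0 => k _; apply/ltW/pos.
by rewrite y0 !cx0 addr0 ltxx.
Qed.

Lemma sign_changes b : isroot W rho b ->
  (\sum_(k < #[c]%g) (sg (b *m rho (c ^+ k)%g) != sg (b *m rho (c ^+ k.+1)%g)) = 2)%N.
Proof.
move=> rb; pose s k := sg (b *m rho (c ^+ k)%g).
have per k : s (k + #[c]%g)%N = s k by rewrite /s expgD expg_order mulg1.
have [k2 s2] := exists_neg_in_orbit rb.
have [k1] := exists_neg_in_orbit (isrootN gd rb).
rewrite mulNmx sgN ?negbK => [s1|]; last exact: isroot_c.
(* Both signs occur in the orbit; starting it at a descent gives the pattern of
   [sum_two_changes]. *)
have [k0 sk0 nsk0] := periodic_descent (order_gt0 c) per s1 s2.
have [||p pb sp] := sg_after_descent (isroot_c k0 rb) => //; first by rewrite -mul_cS.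
have := @sum_two_changes (fun k => s (k + k0)%N) _ _ pb sk0.
move=> two; rewrite -[RHS]two => [|k kh]; last by rewrite -(sp k kh) /s mul_cX_add.
have perf k : (s (k + #[c]%g)%N != s (k + #[c]%g)%N.+1 : nat) = (s k != s k.+1).
  by rewrite -addSn !per.
exact: esym (sum_shift_periodic k0 perf).
Qed.

(** * The reflections that begin a factorization of c *)

Definition pre j := take (index j bip_word) bip_word.
Definition post j := drop (index j bip_word).+1 bip_word.
Definition cox_refl j := (g j ^ (wordg (pre j))^-1)%g.

Lemma bip_splitE j : bip_word = pre j ++ j :: post j.
Proof.
rewrite -[LHS](cat_take_drop (index j bip_word)); congr cat.
by rewrite (drop_nth j) ?index_mem ?mem_bip_word // nth_index // mem_bip_word.
Qed.

Lemma bip_split_uniq j : [/\ uniq (pre j ++ post j), j \notin pre j & j \notin post j].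
Proof.
have := bip_word_uniq; rewrite (bip_splitE j) uniq_catC cons_uniq mem_cat negb_or.
by case/andP => /andP[jpost jpre]; rewrite uniq_catC.
Qed.

Lemma mem_bip_split j k : (k \in pre j ++ post j) = (k != j).
Proof.
have [_ j1 j2] := bip_split_uniq j; have [->|kj] := eqVneq k j.
  by rewrite mem_cat (negPf j1) (negPf j2).
by have := mem_bip_word k; rewrite {1}(bip_splitE j) !mem_cat inE (negPf kj).
Qed.

Lemma pre_unique r1 j r2 : bip_word = r1 ++ j :: r2 -> r1 = pre j.
Proof.
move=> e; have := bip_word_uniq; rewrite e cat_uniq => /and3P[_ /hasPn/(_ j)].
rewrite mem_head => /(_ isT) jr1 _; rewrite /pre e index_cat (negPf jr1) /= eqxx addn0.
by rewrite take_size_cat.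
Qed.

Lemma wordg_rev r : wordg (rev r) = (wordg r)^-1%g.
Proof.
elim: r => [|i r IH]; first by rewrite /word_prod !big_nil invg1.
by rewrite rev_cons wordg_rcons wordg_cons IH invMg (gd_inv gd).
Qed.

Lemma sg_coord b j : isroot W rho b -> 0 < b 0 j -> sg b.
Proof.
move=> rb bj; apply: nnv_sg => //; have [//|neg] := isroot_sign gd rb.
by have := neg j; rewrite mxE oppr_ge0 leNgt bj.
Qed.

Definition cox_root j := al j *m rho (wordg (pre j))^-1%g.

Lemma cox_root_isroot j : isroot W rho (cox_root j).
Proof.
by apply: (isroot_rho gd); rewrite ?groupV ?(wordgW gd) //; apply: (isroot_sroot gd).
Qed.

Lemma cox_root_coord j k : k \notin pre j -> cox_root j 0 k = (k == j)%:R.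
Proof.
move=> kj; rewrite /cox_root -wordg_rev (mul_wordg_notin gd) ?mem_rev //.
by rewrite mxE eq_sym.
Qed.

Lemma cox_root_sg j : sg (cox_root j).
Proof.
have [_ j1 _] := bip_split_uniq j; apply: (sg_coord (j := j)); first exact: cox_root_isroot.
by rewrite cox_root_coord // eqxx ltr01.
Qed.

Lemma cox_root_c j : ~~ sg (cox_root j *m rho c).
Proof.
have [_ j1 j2] := bip_split_uniq j.
have -> : cox_root j *m rho c = - (al j *m rho (wordg (post j))).
  rewrite /c (bip_splitE j) wordg_cat wordg_cons !(gd_rhoM gd) ?groupM ?(wordgW gd) ?(gd_inW gd) //.
  rewrite /cox_root !mulmxA -(mulmxA (al j)) (gd_rhoVK gd) ?(wordgW gd) // mulmx1.
  by rewrite (gd_rho_g gd) refl_self ?(gd_sroot1 gd) // mulNmx.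
have rp : isroot W rho (al j *m rho (wordg (post j))).
  by apply: (isroot_rho gd); [apply: (isroot_sroot gd)|apply: (wordgW gd)].
rewrite sgN // negbK; apply: (sg_coord (j := j)) => //.
by rewrite (mul_wordg_notin gd) // mxE !eqxx ltr01.
Qed.

Lemma rho_cox_refl j : rho (cox_refl j) = refl B (cox_root j).
Proof. by rewrite (rho_conj gd) // groupV (wordgW gd). Qed.

Lemma cox_refl_in j : cox_refl j \in reflections W S.
Proof.
by apply/(reflectionsP gd); exists j, (wordg (pre j))^-1%g; rewrite ?groupV ?(wordgW gd).
Qed.

(** If j does not occur before k, the coordinate j is 0 in [cox_root k] and 1 in [cox_root j], so
    these roots are not opposite or equal. Of two letters, one does not occur before the other. *)
Lemma cox_refl_inj : injective cox_refl.
Proof.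
have before j k : j != k -> j \notin pre k -> cox_refl j <> cox_refl k.
  move=> jk jpre eqjk; have [_ jj _] := bip_split_uniq j.
  have e : refl B (cox_root j) = refl B (cox_root k) by rewrite -!rho_cox_refl eqjk.
  have c1 : cox_root j 0 j = 1 by rewrite cox_root_coord // eqxx.
  have c2 : cox_root k 0 j = 0 by rewrite cox_root_coord // (negPf jk).
  have [e'|e'] := refl_eq gd (cox_root_isroot j) (cox_root_isroot k) e.
    by move: c1; rewrite e' c2 => /eqP; rewrite eq_sym oner_eq0.
  by move: c1; rewrite e' mxE c2 oppr0 => /eqP; rewrite eq_sym oner_eq0.
move=> j k eqjk; apply/eqP; apply: contraT => jk.
have [jpre|/(before _ _ jk)//] := boolP (j \in pre k).
have kpre : k \notin pre j.
  apply/negP => kpre; have lt a b : a \in pre b -> (index a bip_word < index b bip_word)%N.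
    move=> ab; rewrite -[X in index a X](cat_take_drop (index b bip_word)) index_cat ab.
    by move: ab; rewrite -index_mem => /leq_trans; apply; rewrite size_take; case: ltnP.
  have := lt _ _ jpre; have := lt _ _ kpre; lia.
by case: (before k j _ kpre); rewrite // eq_sym.
Qed.

Lemma cox_reflP t b : t \in reflections W S -> isroot W rho b -> rho t = refl B b ->
  (sg b != sg (b *m rho c)) = (t \in [set cox_refl j | j : 'I_n]).
Proof.
move=> Tt rb tE; apply/idP/imsetP => [|[j _ tj]]; last first.
  have e : refl B (cox_root j) = refl B b by rewrite -rho_cox_refl -tj.
  have [s1 s2] := (cox_root_sg j, negPf (cox_root_c j)).
  have [<-|e'] := refl_eq gd (cox_root_isroot j) rb e; first by rewrite s1 s2.
  by move: s1 s2; rewrite e' mulNmx (sgN rb) (sgN (isroot_c1 rb)) => /negPf-> /negbFE->.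
(* b and -b have the same reflection and the same sign changes. *)
wlog sb : b rb tE / sg b => [wl|] ch.
  have [sb|nsb] := boolP (sg b); first exact: wl ch.
  apply: (wl (- b)); rewrite ?mulNmx ?(sgN rb) ?(sgN (isroot_c1 rb)) //; first exact: (isrootN gd).
    rewrite tE; apply/row_matrixP => k; rewrite !rowE !mul_refl bfNr ?gram_sym //.
    by rewrite mulrN scaleNr scalerN !opprK.
  by move: ch; case: (sg b); case: (sg _).
have neg : nnv (- (b *m rho c)).
  apply: sg_nnv; first by apply: (isrootN gd); apply: isroot_c1.
  by move: ch; rewrite (sgN (isroot_c1 rb)) sb; case: (sg _).
have [r1 [j [r2 [wE bE]]]] := root_flip gd rb (sg_nnv rb sb) neg.
exists j => //; apply: (rho_inj gd).
- exact: (fintype.subsetP (reflections_sub gd)).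
- exact: (fintype.subsetP (reflections_sub gd) _ (cox_refl_in j)).
rewrite rho_cox_refl tE /cox_root -(pre_unique wE) -bE -mulmxA (gd_rhoK gd) ?mulmx1 //.
exact: (wordgW gd).
Qed.

Lemma root_conj t b w : t \in W -> isroot W rho b -> rho t = refl B b -> w \in W ->
  rho (t ^ w)%g = refl B (b *m rho w).
Proof.
move=> Wt [i [u Wu ->]] tE Ww.
have -> : t = (g i ^ u)%g.
  by apply: (rho_inj gd); rewrite ?groupJ ?(gd_inW gd) // tE (rho_conj gd).
by rewrite -conjgM (rho_conj gd) ?groupM // (gd_rhoM gd) // mulmxA.
Qed.

Lemma cox_refl_hits t : t \in reflections W S ->
  (\sum_(k < #[c]%g) (((t ^ (c ^+ k))%g \in [set cox_refl j | j : 'I_n])) = 2)%N.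
Proof.
move=> Tt; have [b [rb _ tE]] := reflection_root gd Tt.
have Wt := fintype.subsetP (reflections_sub gd) _ Tt.
rewrite -(sign_changes rb); apply: eq_bigr => k _; congr (nat_of_bool _).
rewrite mul_cS; apply/esym/cox_reflP; last by apply: root_conj; rewrite // groupX ?cW.
- by apply: (reflectionsJ gd) => //; rewrite groupX ?cW.
- exact: isroot_c.
Qed.

(** Double counting of pairs of a reflection t and an exponent k with [t ^ (c ^+ k)] in [N],
    weighted by [F]: for fixed t there are two such k, and for fixed k conjugation permutes the
    reflections. *)
Lemma facts_count : (2 * #|facts (reflections W S) n c| =
  #[c]%g * \sum_j #|facts (reflections W S) n.-1 (wordg (pre j ++ post j))|)%N.
Proof.
set T := reflections W S; pose F t := #|facts T n.-1 (t^-1 * c)%g|.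
have n0 : (0 < n)%N by rewrite (leq_ltn_trans _ (ltn_ord i0)).
have recl k : (0 < k)%N -> #|facts T k c| = (\sum_(t in T) #|facts T k.-1 (t^-1 * c)%g|)%N.
  by case: k => // k _; apply: card_facts_recl.
rewrite {}recl //.
have FJ t k : t \in T -> F (t ^ (c ^+ k))%g = F t.
  move=> Tt; rewrite /F.
  have -> : ((t ^ (c ^+ k))^-1 * c = (t^-1 * c) ^ (c ^+ k))%g.
    rewrite conjMg conjVg; congr (_ * _)%g; apply/esym/conjg_fixP.
    by apply/commgP/commuteX.
  by apply: card_factsJ => s Ts; apply: (reflectionsJ gd) => //; rewrite ?groupV groupX ?cW.
set N := [set cox_refl j | j : 'I_n].
transitivity (\sum_(t in T) \sum_(k < #[c]%g) F (t ^ (c ^+ k))%g * ((t ^ (c ^+ k))%g \in N))%N.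
  rewrite big_distrr /=; apply: eq_bigr => t Tt; rewrite -(cox_refl_hits Tt) mulnC big_distrr /=.
  by apply: eq_bigr => k _; rewrite FJ.
rewrite exchange_big /= (eq_bigr (fun _ => \sum_j F (cox_refl j))%N) => [|k _].
  rewrite sum_nat_const card_ord; congr (_ * _)%N; apply: eq_bigr => j _; rewrite /F.
  congr #|pred_of_set (facts _ _ _)|.
  (* Cancelling [cox_refl j] at the front of c deletes the letter j from the word. *)
  rewrite /c {1}(bip_splitE j) /cox_refl !wordg_cat wordg_cons -conjVg (gd_inv gd) conjgE invgK.
  by rewrite !mulgA mulgKV -(mulgA _ (g j) (g j)) (gd_sq gd) mulg1.
have Wck : (c ^+ k)%g \in W by rewrite groupX ?cW.
transitivity (\sum_(t in T) F t * (t \in N))%N.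
  rewrite [RHS](reindex_inj (conjg_inj (c ^+ k)%g)); apply: eq_bigl => t.
  apply/idP/idP => [|Tt]; first exact: (reflectionsJ gd).
  by rewrite -[t](conjgK (c ^+ k)%g); apply: (reflectionsJ gd); rewrite ?groupV.
rewrite (bigID (mem N)) /= [X in (_ + X)%N]big1 ?addn0 => [|t /andP[_ /negPf->]]; last first.
  by rewrite muln0.
rewrite -(big_imset F (h := cox_refl) (A := mem 'I_n)) /=; last first.
  by move=> ? ? _ _; apply: cox_refl_inj.
apply: eq_big => [t|t /andP[_ ->]]; last by rewrite muln1.
apply/andP/idP => [[]//|Nt]; split=> //.
by case/imsetP: Nt => j _ ->; apply: cox_refl_in.
Qed.

End CoxeterPlane.

(** * The recursion for maximal chains *)

Local Open Scope ring_scope.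

Lemma MC_recursion (R : realType) (gT : finGroupType) (W : {group gT}) (S : {set gT})
    (n : nat) (g : 'I_n -> gT) (rho : gT -> 'M[R]_n) (c0 c : gT) (d : gT -> gT) :
    geom_datum W S g rho -> coxeter_irreducible S ->
    coxeter_element S c0 -> coxeter_element S c ->
    (forall s, s \in S -> coxeter_element (S :\ s) (d s)) ->
  (2 * MC W S c = #[c0]%g * \sum_i MC (parabolic S (g i)) (S :\ g i) (d (g i)))%N.
Proof.
move=> gd hirr cox0 cox hd.
have [/set0Pn[_ /(gd_im gd)[i0 _]] _] := hirr.
have [col colP] := forest_coloring (@adjC _ _ g) (adj_forest gd hirr).
(* Colours are normalised so that [i0] has colour true, since the orbit of [al i0] governs the
   Chebyshev values. *)
pose col' i := col i == col i0.
have col'P i j : i != j -> adj g i j -> col' i != col' j.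
  move=> ij /(colP _ _ ij); rewrite /col'.
  by case: (col i) (col j) (col i0) => -[] [].
have n0 : (0 < n)%N by apply: leq_ltn_trans (ltn_ord i0).
have conn (P : 'I_n -> Prop) : (forall i j, gram R g i j < 0 -> P i -> P j) ->
    forall i j, P i -> P j.
  move=> stepP; apply: (irr_ind gd hirr) => i j ij; apply: stepP.
  by have := gram_edge R ij; lra.
have [mu [v v_gt0 v_eigen]] := perron (gram_sym R g) n0 (gram_le0 gd) conn.
have col_i0 : col' i0 by rewrite /col'.
have := facts_count gd hirr col'P col_i0 v_gt0 v_eigen.
rewrite -(MC_coxeter gd hirr cox (bip_word_uniq col')) //; last exact: mem_bip_word.
have -> : #[word_prod g (bip_word col')]%g = #[c0]%g.
  have [r [ur rE ->]] := coxeter_element_word gd (fintype.subxx S) cox0.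
  have [|i _|w _ ->] := coxeter_words_conj gd hirr (H := W) (bip_word_uniq col') ur.
  - by move=> i; rewrite mem_bip_word rE (gd_in gd).
  - exact: (gd_inW gd).
  by rewrite orderJ.
move=> ->; congr (_ * _)%N; apply: eq_bigr => j _.
have [ur _ _] := bip_split_uniq col' j.
by rewrite (MC_parabolic gd hirr (hd _ (gd_in gd j)) ur) // => k; apply: mem_bip_split.
Qed.

Section RealNumbers.
Import Rstruct.
(** The recursion concerns natural numbers; one concrete model of the reals supplies pi, cosines and
    compactness. *)
Definition stdlib_realType : realType := Rdefinitions.R.
End RealNumbers.

Theorem corollary3p1 (gT : finGroupType) (W : {group gT}) (S : {set gT})
    (hWS : coxeter_system W S) (hirr : coxeter_irreducible S)
    (h : nat) (hh : exists2 c0 : gT, coxeter_element S c0 & h = #[c0]%g)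
    (c : gT) (hc : coxeter_element S c)
    (d : gT -> gT)
    (hd : forall s : gT, s \in S -> coxeter_element (S :\ s) (d s)) :
  (MC W S c)%:R =
    h%:R / 2 * \sum_(s in S) (MC (parabolic S s) (S :\ s) (d s))%:R :> rat.
Proof.
have [rho gd] := ex_geom_datum stdlib_realType hWS.
case: hh => c0 cox0 ->.
have := MC_recursion gd hirr cox0 hc hd.
have -> : (\sum_(i < #|S|) MC (parabolic S (enum_val i)) (S :\ enum_val i) (d (enum_val i)) =
    \sum_(s in S) MC (parabolic S s) (S :\ s) (d s))%N by rewrite [RHS]big_enum_val.
move=> /(congr1 (fun k : nat => k%:R : rat)); rewrite !natrM natr_sum => e.
by rewrite mulrAC -e mulrAC divff ?mul1r // pnatr_eq0.
Qed.
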